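(* Let $n\ge 3$ and let $K\subset\mathbb R^n$ be a convex body. For every $i\in\{2,\dots,n-1\}$ we have \[ \frac{R_{n-i+1}(K)}{r_i(K)} \leq \min\left\{ i\sqrt{2}\,\sqrt{1-\frac{1}{n-i+2}}\,,\; 2^{n-i}\sqrt{(n-i+1)(i+1)} \right\}. \]
   Context: A convex body in $\mathbb R^n$ is a compact convex subset of $\mathbb R^n$ with non-empty interior. All notions are with respect to the Euclidean norm. For $1\le j\le n$, the $j$-th successive outer radius of $K$ is $R_j(K)=\min\{R(P_L(K)) : L \text{ a } j\text{-dimensional affine subspace of } \mathbb R^n\}$, where $P_L(K)$ is the orthogonal projection of $K$ onto $L$ and $R(\cdot)$ is the circumradius, i.e. the smallest radius of a Euclidean ball containing the set. The $j$-th successive inner radius of $K$ is $r_j(K)=\max\{r_L(K\cap L): L \text{ a } j\text{-dimensional affine subspace of } \mathbb R^n \text{ with } K\cap L\neq\emptyset\}$, where $r_L(C)$ is the inradius of $C\subset L$ measured within $L$, i.e. the largest $\rho\ge 0$ such that $C$ contains a $j$-dimensional Euclidean ball of $L$ of radius $\rho$. Equivalently, $r_j(K)$ is the largest radius of a $j$-dimensional Euclidean disc contained in $K$, and $R_j(K)$ is the smallest radius of a solid cylinder with $j$-dimensional spherical cross-section containing $K$. *)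

(* Defs.v *)
From HB Require Import structures.
From mathcomp Require Export all_boot all_order all_algebra.
From mathcomp Require Export all_classical all_reals all_analysis.

Set Implicit Arguments.
Unset Strict Implicit.
Unset Printing Implicit Defensive.

Import Order.TTheory GRing.Theory Num.Theory.
Import numFieldNormedType.Exports.

Local Open Scope classical_set_scope.
Local Open Scope ring_scope.

(* R^n is 'rV[R]_n.  Its library norm `|x| is the sup norm: it induces the
   usual topology (used for compactness and interior), but all metric notions
   below use the Euclidean norm enorm instead. *)
Definition dotv (R : realType) (n : nat) (u v : 'rV[R]_n) : R :=
  \sum_(i < n) u 0 i * v 0 i.

Definition enorm (R : realType) (n : nat) (u : 'rV[R]_n) : R :=
  Num.sqrt (dotv u u).

Definition eball (R : realType) (n : nat) (c : 'rV[R]_n) (rho : R) :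
  set 'rV[R]_n := [set x | enorm (x - c) <= rho].

Definition convex_body (R : realType) (n : nat) (K : set 'rV[R]_n) : Prop :=
  [/\ compact K, convex_set K & interior K !=set0].

Definition affine_subspace (R : realType) (n j : nat) (L : set 'rV[R]_n) :
  Prop :=
  exists (p : 'rV[R]_n) (V : {vspace 'rV[R]_n}),
    \dim V = j /\ L = [set x | x - p \in V].

(* P_L(K): the y in L such that x - y is orthogonal to the direction of L for
   some x in K. *)
Definition orth_proj (R : realType) (n : nat) (L K : set 'rV[R]_n) :
  set 'rV[R]_n :=
  [set y | L y /\
    exists2 x, K x & forall z, L z -> dotv (x - y) (z - y) = 0].

(* The minima and maxima defining the radii below are attained when K is a
   convex body and 1 <= j <= n, so they are written as inf and sup, which are
   total on sets of reals. *)
Definition circumradius (R : realType) (n : nat) (C : set 'rV[R]_n) : R :=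
  inf [set rho | 0 <= rho /\ exists c, C `<=` eball c rho].

Definition inradius (R : realType) (n : nat) (L C : set 'rV[R]_n) : R :=
  sup [set rho | 0 <= rho /\ exists2 c, L c & L `&` eball c rho `<=` C].

Definition outer_radius (R : realType) (n j : nat) (K : set 'rV[R]_n) : R :=
  inf [set circumradius (orth_proj L K) | L in affine_subspace j].

Definition inner_radius (R : realType) (n j : nat) (K : set 'rV[R]_n) : R :=
  sup [set inradius L (K `&` L) |
       L in [set L | affine_subspace j L /\ K `&` L !=set0]].

(* Main.v *)
Require Import Defs.
From mathcomp Require Import perm ring lra.
Import Order.TTheory GRing.Theory Num.Theory.
Import numFieldNormedType.Exports.

Set Implicit Arguments.
Unset Strict Implicit.
Unset Printing Implicit Defensive.

Local Open Scope classical_set_scope.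
Local Open Scope ring_scope.

(* A [j]-dimensional subspace is represented by a matrix [U] with [j]
   orthonormal rows, so that [x *m U^T] gives the coordinates of the orthogonal
   projection of [x].

   First bound.  Choose [v_1, ..., v_i] in [K - K] spanning (nearly) maximal
   volume and let [h] be the least distance of a [v_j] from the span of the
   others.  An average of [i] segments of [K] parallel to the [v_l] is a
   translate in [K] of the parallelepiped with edges [v_l / i], which contains
   an [i]-disc of radius [h / (2 i)].  By maximality, the projection of [K]
   along the other [i - 1] vectors has diameter (nearly) at most [h], and Jung's
   theorem in dimension [n - i + 1] bounds its circumradius.

   Second bound.  Project repeatedly along a direction [u] of minimal width.
   Some segment of [K] in direction [u] crosses the whole slab of minimal
   width, so [K] contains a half-size copy of every disc in its projection.
   After [n - i] steps Steinhagen's inequality in dimension [i] gives a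
   direction of half-width at most [sqrt (i + 1)] times the inradius.  The
   minimal widths increase along the way, so all [n - i + 1] orthonormal
   directions found have half-width at most [2 ^ (n - i) sqrt (i + 1) r_i].

   Jung's and Steinhagen's inequalities both come from the first-order
   optimality conditions of [a |c|^2 + sum lam_k g (p_k)], where [c] is the mean
   of the weighted points [p_k]. *)

(** * Euclidean inner product and norm *)

Section Euclidean.
Variable R : realType.

Section Dot.
Variable n : nat.
Implicit Types (u v w : 'rV[R]_n) (a r : R).

Lemma dotvE u v : dotv u v = (u *m v^T) 0 0.
Proof. by rewrite mxE; apply: eq_bigr => i _; rewrite mxE. Qed.

Lemma dotvC u v : dotv u v = dotv v u.
Proof. by apply: eq_bigr => i _; rewrite mulrC. Qed.

Lemma dotvDl u v w : dotv (u + v) w = dotv u w + dotv v w.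
Proof. by rewrite !dotvE mulmxDl mxE. Qed.

Lemma dotvDr u v w : dotv w (u + v) = dotv w u + dotv w v.
Proof. by rewrite dotvC dotvDl !(dotvC _ w). Qed.

Lemma dotvZl a u v : dotv (a *: u) v = a * dotv u v.
Proof. by rewrite !dotvE -scalemxAl mxE. Qed.

Lemma dotvZr a u v : dotv v (a *: u) = a * dotv v u.
Proof. by rewrite dotvC dotvZl dotvC. Qed.

Lemma dotvNl u v : dotv (- u) v = - dotv u v.
Proof. by rewrite -scaleN1r dotvZl mulN1r. Qed.

Lemma dotvNr u v : dotv v (- u) = - dotv v u.
Proof. by rewrite dotvC dotvNl dotvC. Qed.

Lemma dotv0l u : dotv 0 u = 0.
Proof. by rewrite -(scale0r u) dotvZl mul0r. Qed.

Lemma dotv0r u : dotv u 0 = 0.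
Proof. by rewrite dotvC dotv0l. Qed.

Definition dotv_lin := (dotvDl, dotvDr, dotvNl, dotvNr, dotvZl, dotvZr).

Lemma dotv_suml (I : finType) (P : pred I) (F : I -> 'rV[R]_n) v :
  dotv (\sum_(k | P k) F k) v = \sum_(k | P k) dotv (F k) v.
Proof.
apply: (big_morph (fun x => dotv x v)); last exact: dotv0l.
by move=> x y; rewrite dotvDl.
Qed.

Lemma dotv_sumr (I : finType) (P : pred I) (F : I -> 'rV[R]_n) v :
  dotv v (\sum_(k | P k) F k) = \sum_(k | P k) dotv v (F k).
Proof. by rewrite dotvC dotv_suml; apply: eq_bigr => k _; rewrite dotvC. Qed.

Lemma dotv_ge0 u : 0 <= dotv u u.
Proof. by apply: sumr_ge0 => i _; rewrite -expr2 sqr_ge0. Qed.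

Lemma dotv_eq0 u : (dotv u u == 0) = (u == 0).
Proof.
apply/eqP/eqP => [|->]; last exact: dotv0l.
move/eqP; rewrite psumr_eq0 => [/allP h|i _]; last by rewrite -expr2 sqr_ge0.
apply/rowP => i; rewrite mxE; apply/eqP.
by have := h i (mem_index_enum i); rewrite /= mulf_eq0 orbb.
Qed.

Lemma dotv_gt0 u : (0 < dotv u u) = (u != 0).
Proof. by rewrite lt_def dotv_eq0 dotv_ge0 andbT. Qed.

Lemma enorm_ge0 u : 0 <= enorm u. Proof. exact: sqrtr_ge0. Qed.

Lemma enorm_sq u : enorm u ^+ 2 = dotv u u.
Proof. by rewrite sqr_sqrtr ?dotv_ge0. Qed.

Lemma enorm0 : enorm (0 : 'rV[R]_n) = 0.
Proof. by rewrite /enorm dotv0l sqrtr0. Qed.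

Lemma enorm_eq0 u : (enorm u == 0) = (u == 0).
Proof. by rewrite -dotv_eq0 -enorm_sq sqrf_eq0. Qed.

Lemma enorm_gt0 u : (0 < enorm u) = (u != 0).
Proof. by rewrite lt_def enorm_ge0 enorm_eq0 andbT. Qed.

Lemma enormZ a u : enorm (a *: u) = `|a| * enorm u.
Proof.
by rewrite /enorm dotvZl dotvZr mulrA -expr2 sqrtrM ?sqr_ge0// sqrtr_sqr.
Qed.

Lemma enormN u : enorm (- u) = enorm u.
Proof. by rewrite -scaleN1r enormZ normrN normr1 mul1r. Qed.

Lemma enorm_leP u r : 0 <= r -> (enorm u <= r) = (dotv u u <= r ^+ 2).
Proof. by move=> r0; rewrite -enorm_sq ler_pXn2r ?nnegrE ?enorm_ge0. Qed.

Lemma dotv_le u v : dotv u v <= enorm u * enorm v.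
Proof.
have [->|v0] := eqVneq v 0; first by rewrite dotv0r enorm0 mulr0.
have vv : 0 < dotv v v by rewrite dotv_gt0.
have h : 0 <= dotv u u * dotv v v - dotv u v ^+ 2.
  have := dotv_ge0 (dotv v v *: u - dotv u v *: v).
  rewrite !dotv_lin (dotvC v u).
  move=> h; rewrite -(pmulr_rge0 _ vv); apply: le_trans h _.
  by rewrite le_eqVlt; apply/orP; left; apply/eqP; ring.
apply: le_trans (ler_norm _) _.
rewrite -(@ler_pXn2r _ 2) ?nnegrE ?mulr_ge0 ?enorm_ge0//.
by rewrite exprMn !enorm_sq real_normK ?num_real// -subr_ge0.
Qed.

Lemma dotv_abs_le u v : `|dotv u v| <= enorm u * enorm v.
Proof. by rewrite ler_norml dotv_le andbT lerNl -dotvNl -(enormN u) dotv_le. Qed.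

Lemma enormD u v : enorm (u + v) <= enorm u + enorm v.
Proof.
rewrite enorm_leP ?addr_ge0 ?enorm_ge0// sqrrD !enorm_sq !dotv_lin (dotvC v u).
have := dotv_le u v; lra.
Qed.

Lemma enormB u v : enorm (u - v) <= enorm u + enorm v.
Proof. by rewrite -(enormN v) enormD. Qed.

Lemma enorm_subC u v : enorm (u - v) = enorm (v - u).
Proof. by rewrite -enormN opprB. Qed.

Lemma enorm_normalize u : u != 0 -> enorm ((enorm u)^-1 *: u) = 1.
Proof.
move=> u0; rewrite enormZ ger0_norm ?invr_ge0 ?enorm_ge0//.
by rewrite mulVf ?enorm_eq0.
Qed.

End Dot.

Lemma unit_vector_exists n : exists u : 'rV[R]_n.+1, enorm u = 1.
Proof.
exists ((enorm (const_mx 1 : 'rV[R]_n.+1))^-1 *: const_mx 1).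
apply: enorm_normalize; apply/eqP => /rowP /(_ 0); rewrite !mxE.
by move/eqP; rewrite oner_eq0.
Qed.

Lemma dotv_mulmx m n (u : 'rV[R]_m) (A : 'M[R]_(m, n)) v :
  dotv (u *m A) v = dotv u (v *m A^T).
Proof. by rewrite !dotvE trmx_mul trmxK mulmxA. Qed.

Lemma dotv_row m n (A : 'M[R]_(m, n)) v i : dotv v (row i A) = (v *m A^T) 0 i.
Proof. by rewrite [RHS]mxE; apply: eq_bigr => j _; rewrite !mxE. Qed.

Lemma enorm_isometry m n (U : 'M[R]_(m, n)) s :
  U *m U^T = 1%:M -> enorm (s *m U) = enorm s.
Proof. by move=> h; rewrite /enorm dotv_mulmx -mulmxA h mulmx1. Qed.

Lemma enorm_proj m n (U : 'M[R]_(m, n)) x :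
  U *m U^T = 1%:M -> enorm (x *m U^T) <= enorm x.
Proof.
move=> h; rewrite enorm_leP ?enorm_ge0// enorm_sq.
have := dotv_ge0 (x - x *m U^T *m U).
rewrite !dotv_lin (dotv_mulmx (x *m U^T)) (dotv_mulmx (x *m U^T)).
rewrite (dotvC x (_ *m U)) dotv_mulmx -(mulmxA (x *m U^T)) h mulmx1; lra.
Qed.

End Euclidean.

(** * Finite weighted configurations and Jung's theorem *)

Section WeightedPoints.
Variable R : realType.

Definition weights N (lam : 'I_N -> R) :=
  (forall k, 0 <= lam k) /\ \sum_k lam k = 1.

(** The vectors [(1, p k)] number one more than their dimension, and a nonzero [mu] with zero sum
    has a negative entry. *)
Lemma affine_dependence m (p : 'I_m.+2 -> 'rV[R]_m) :
  exists mu : 'I_m.+2 -> R,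
    [/\ \sum_k mu k = 0, \sum_k mu k *: p k = 0 & exists k, mu k < 0].
Proof.
pose P : 'M[R]_(m.+2, 1 + m) := \matrix_k row_mx 1%:M (p k).
have : kermx P != 0.
  rewrite kermx_eq0 /row_free neq_ltn (leq_ltn_trans (rank_leq_col P))//.
case/rowV0Pn => v /sub_kermxP vP v0.
have s1 : \sum_k v 0 k = 0.
  have /(congr1 (fun M : 'rV_(1 + m) => M 0 (lshift m 0))) := vP.
  rewrite mxE [X in _ = X -> _]mxE => h; rewrite -[RHS]h; apply: eq_bigr => k _.
  by rewrite mxE row_mxEl mxE eqxx mulr1.
have s2 : \sum_k v 0 k *: p k = 0.
  apply/rowP => j; rewrite summxE mxE.
  have /(congr1 (fun M : 'rV_(1 + m) => M 0 (rshift 1 j))) := vP.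
  rewrite mxE [X in _ = X -> _]mxE => h; rewrite -[RHS]h; apply: eq_bigr => k _.
  by rewrite [LHS]mxE [X in _ = _ * X]mxE row_mxEr.
exists (v 0); split => //; apply: contrapT => h.
have v_ge0 k : 0 <= v 0 k by rewrite leNgt; apply/negP => hk; apply: h; exists k.
case/negP: v0; apply/eqP/rowP => k; rewrite mxE; apply/eqP.
move/eqP: s1; rewrite psumr_eq0 => // /allP /(_ k (mem_index_enum k)); exact.
Qed.

(** The weights slide along an affine dependence, oriented so that the [g]-cost does not grow, until
    the first of them vanishes. *)
Lemma caratheodory m (p : 'I_m.+2 -> 'rV[R]_m) (g lam : 'I_m.+2 -> R) :
  weights lam -> exists lam' : 'I_m.+2 -> R,
  [/\ weights lam', \sum_k lam' k *: p k = \sum_k lam k *: p k,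
      \sum_k lam' k * g k <= \sum_k lam k * g k & exists k, lam' k = 0].
Proof.
move=> [lam0 lam1].
have [mu [mu1 mup [k0 mu0] mug]] : exists mu : 'I_m.+2 -> R,
    [/\ \sum_k mu k = 0, \sum_k mu k *: p k = 0, exists k, mu k < 0
      & \sum_k mu k * g k <= 0].
  have [mu [mu1 mup [k0 mu0]]] := affine_dependence p.
  have [h|h] := leP (\sum_k mu k * g k) 0.
    by exists mu; split => //; exists k0.
  exists (fun k => - mu k); split.
  - by rewrite sumrN mu1 oppr0.
  - by under eq_bigr do rewrite scaleNr; rewrite sumrN mup oppr0.
  - apply: contrapT => h'.
    have mu_le0 k : 0 <= - mu k by rewrite leNgt; apply/negP => hk; apply: h'; exists k.
    move: mu1 => /(congr1 -%R); rewrite oppr0 -sumrN => /eqP.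
    rewrite psumr_eq0 => // /allP /(_ k0 (mem_index_enum k0)).
    by rewrite /= oppr_eq0 lt_eqF.
  - by under eq_bigr do rewrite mulNr; rewrite sumrN oppr_le0 ltW.
case: (@arg_minP _ R _ k0 (fun k => mu k < 0) (fun k => lam k / - mu k)) => //.
move=> k1 mu_k1 k1min; pose s := lam k1 / - mu k1.
have s0 : 0 <= s by rewrite divr_ge0// oppr_ge0 ltW.
exists (fun k => lam k + s * mu k); split; first split.
- move=> k; have [muk|muk] := ltP (mu k) 0; last by rewrite addr_ge0// mulr_ge0.
  rewrite -lerBlDr sub0r -mulrN -ler_pdivlMr ?oppr_gt0//; exact: k1min.
- by rewrite big_split/= -mulr_sumr mu1 mulr0 addr0.
- under eq_bigr do rewrite scalerDl -scalerA.
  by rewrite big_split/= -scaler_sumr mup scaler0 addr0.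
- under eq_bigr do rewrite mulrDl -mulrA.
  by rewrite big_split/= -mulr_sumr gerDl mulr_ge0_le0.
- exists k1; rewrite /s invrN mulrN mulNr -mulrA mulVf ?mulr1 ?subrr//.
  by rewrite lt_eqF.
Qed.

(* Approximate first-order optimality for the minimum of
   [a * |mean|^2 + sum lam_k g(p_k)]: moving mass to [x] cannot decrease it
   much, and by Caratheodory [m + 1] points suffice. *)
Lemma near_min_config m (S : set 'rV[R]_m) (g : 'rV[R]_m -> R) (a B b eta : R) :
  0 <= a -> S !=set0 -> (forall x, S x -> enorm x <= B) ->
  (forall x, S x -> b <= g x) -> 0 < eta ->
  exists (lam : 'I_m.+1 -> R) (p : 'I_m.+1 -> 'rV[R]_m) (c : 'rV[R]_m),
  [/\ weights lam, forall k, S (p k), c = \sum_k lam k *: p k &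
      forall x, S x -> 2 * a * dotv c c + \sum_k lam k * g (p k) - eta <=
                       2 * a * dotv c x + g x].
Proof.
move=> a0 [x0 Sx0] SB Sb eta0.
pose mean N (lam : 'I_N -> R) (p : 'I_N -> 'rV[R]_m) := \sum_k lam k *: p k.
pose Phi N (lam : 'I_N -> R) (p : 'I_N -> 'rV[R]_m) :=
  a * dotv (mean N lam p) (mean N lam p) + \sum_k lam k * g (p k).
pose E := [set r | exists (lam : 'I_m.+1 -> R) (p : 'I_m.+1 -> 'rV[R]_m),
  [/\ weights lam, forall k, S (p k) & r = Phi _ lam p]].
have E0 : E !=set0.
  exists (Phi _ (fun k : 'I_m.+1 => (k == 0)%:R) (fun=> x0)).
  exists (fun k : 'I_m.+1 => (k == 0)%:R), (fun=> x0); split => //.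
  split => [k|]; first exact: ler0n.
  rewrite (bigD1 0)//= big1 ?addr0// => k /negPf ->//.
have Elb : has_lbound E.
  exists b => _ [lam [p [[lam0 lam1] Sp ->]]].
  rewrite -[b]add0r lerD ?mulr_ge0 ?dotv_ge0//.
  rewrite -[b]mul1r -lam1 mulr_suml; apply: ler_sum => k _.
  by rewrite ler_wpM2l// Sb.
have B0 : 0 <= B by apply: le_trans (SB _ Sx0); exact: enorm_ge0.
(* Mass [t] will move to [x]. Since [|x - c| <= 2 * B], this choice keeps the quadratic term
   [a * t ^+ 2 * |x - c|^2] at most [t * (eta / 2)]. *)
pose t := Num.min 1 (eta / 2 / (a * (2 * B) ^+ 2 + 1)).
have den0 : 0 < a * (2 * B) ^+ 2 + 1 by rewrite ltr_wpDl ?mulr_ge0 ?sqr_ge0.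
have t0 : 0 < t by rewrite lt_min ltr01/= !divr_gt0.
have t1 : t <= 1 by rewrite ge_min lexx.
have tB : a * t * (2 * B) ^+ 2 <= eta / 2.
  have : t <= eta / 2 / (a * (2 * B) ^+ 2 + 1) by rewrite ge_min lexx orbT.
  rewrite ler_pdivlMr//; set q := _ ^+ 2; nra.
have e0 : 0 < t * (eta / 2) by rewrite mulr_gt0// divr_gt0.
have [_ [lam [p [[lam0 lam1] Sp ->]]] hmin] := inf_adherent e0 (conj E0 Elb).
exists lam, p, (mean _ lam p); split => // x Sx.
set c := mean _ lam p; set G := \sum_k lam k * g (p k).
pose p2 k : 'rV[R]_m := oapp p x (unlift (ord0 : 'I_m.+2) k).
pose lam2 k := oapp (fun j => (1 - t) * lam j) t (unlift (ord0 : 'I_m.+2) k).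
have Sp2 k : S (p2 k) by rewrite /p2; case: unliftP => [j|] _ /=.
have w2 : weights lam2.
  split => [k|].
    rewrite /lam2; case: unliftP => [j|] _ /=; last exact: ltW.
    by rewrite mulr_ge0// subr_ge0.
  rewrite big_ord_recl /lam2 unlift_none/=.
  under eq_bigr do rewrite liftK/=.
  by rewrite -mulr_sumr lam1 mulr1 addrC subrK.
have c2 : mean _ lam2 p2 = c + t *: (x - c).
  rewrite /mean big_ord_recl /lam2 /p2 unlift_none/=.
  under eq_bigr do rewrite liftK/= -scalerA.
  rewrite -scaler_sumr -/(mean _ lam p) -/c scalerBl scale1r scalerBr.
  by rewrite addrC addrAC addrA.
have G2 : \sum_k lam2 k * g (p2 k) = (1 - t) * G + t * g x.
  rewrite big_ord_recl /lam2 /p2 unlift_none/=.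
  under eq_bigr do rewrite liftK/= -mulrA.
  by rewrite -mulr_sumr addrC.
(* Adding [x] gave one point too many for [E]; Caratheodory removes one without raising the
   value. *)
have [lam3 [[lam30 lam31] c3 G3 [k lam3k]]] :=
  caratheodory p2 (fun k => g (p2 k)) w2.
have key : inf E <= Phi _ lam2 p2.
  pose lam4 j := lam3 (lift k j); pose p4 j := p2 (lift k j).
  apply: (@le_trans _ _ (Phi _ lam4 p4)).
    apply: ge_inf => //; exists lam4, p4; split => //; last by move=> j; exact: Sp2.
    split => [j|]; first exact: lam30.
    by rewrite -lam31 (bigD1_ord k)//= lam3k add0r.
  rewrite /Phi.
  have -> : mean _ lam4 p4 = mean _ lam2 p2.
    by rewrite -[RHS]c3 (bigD1_ord k)//= lam3k scale0r add0r.
  rewrite lerD2l; apply: le_trans G3.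
  by rewrite [leRHS](bigD1_ord k)//= lam3k mul0r add0r.
move: key hmin; rewrite /Phi c2 G2 -/c -/G !dotv_lin => key hmin.
have d : dotv (x - c) (x - c) <= (2 * B) ^+ 2.
  rewrite -enorm_leP ?mulr_ge0//; apply: le_trans (enormB _ _) _.
  suff : enorm c <= B by have := SB _ Sx; lra.
  rewrite /c /mean; apply: (@le_trans _ _ (\sum_k lam k * B)); last first.
    by rewrite -mulr_suml lam1 mul1r.
  elim/big_rec2 : _ => [|j u v _ h]; first by rewrite enorm0.
  apply: le_trans (enormD _ _) _; rewrite lerD// enormZ ger0_norm//.
  by rewrite ler_wpM2l// SB.
have atd : a * t * dotv (x - c) (x - c) <= eta / 2.
  by apply: le_trans tB; rewrite ler_wpM2l// mulr_ge0// ltW.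
move: d atd; rewrite !dotv_lin (dotvC x c).
rewrite (dotvC x c) in key.
set cc := dotv c c in key hmin *; set cx := dotv c x in key *.
set xx := dotv x x in key *; set e2 := eta / 2 in e0 hmin *.
have -> : eta = e2 + e2 by rewrite /e2; lra.
move=> d atd; rewrite -subr_ge0 -(pmulr_rge0 _ t0).
nra.
Qed.

End WeightedPoints.

(** * Jung's inequality *)

Section Jung.
Variable R : realType.

(** The difference is the sum of squared deviations from the uniform weights. *)
Lemma weights_sq_ge N (lam : 'I_N.+1 -> R) :
  weights lam -> N.+1%:R^-1 <= \sum_k lam k ^+ 2.
Proof.
move=> [_ lam1]; rewrite -subr_ge0.
have -> : \sum_k lam k ^+ 2 - N.+1%:R^-1 = \sum_k (lam k - N.+1%:R^-1) ^+ 2.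
  transitivity (\sum_k (lam k ^+ 2 + (- (2 * N.+1%:R^-1) * lam k + N.+1%:R^-1 ^+ 2))).
    rewrite !big_split/= -mulr_sumr lam1 sumr_const card_ord -(mulr_natl (_ ^+ 2)).
    by rewrite [N.+1%:R * _ ^+ 2]mulrA mulfV ?pnatr_eq0//; ring.
  by apply: eq_bigr => k _; ring.
by apply: sumr_ge0 => k _; exact: sqr_ge0.
Qed.

Lemma variance_pairs m N (lam : 'I_N -> R) (p : 'I_N -> 'rV[R]_m) :
  weights lam ->
  let c := \sum_k lam k *: p k in
  \sum_k \sum_l lam k * lam l * dotv (p k - p l) (p k - p l) =
  2 * (\sum_k lam k * dotv (p k) (p k) - dotv c c).
Proof.
move=> [_ lam1] c; set V := \sum_k lam k * dotv (p k) (p k).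
transitivity (\sum_k (lam k * dotv (p k) (p k) + lam k * V
                      - 2 * (lam k * dotv (p k) c))).
  apply: eq_bigr => k _.
  transitivity (\sum_l (lam k * dotv (p k) (p k) * lam l
    + lam k * (lam l * dotv (p l) (p l))
    - 2 * lam k * (lam l * dotv (p k) (p l)))).
    by apply: eq_bigr => l _; rewrite !dotv_lin (dotvC (p l)); ring.
  rewrite !big_split/= sumrN -!mulr_sumr lam1 -/V /c dotv_sumr.
  under [in RHS]eq_bigr do rewrite dotvZr.
  by ring.
rewrite !big_split/= sumrN -mulr_suml lam1 -mulr_sumr -/V.
rewrite {2}/c dotv_suml; under [in RHS]eq_bigr do rewrite dotvZl.
by ring.
Qed.

(** With [a = 1] and [g x = - |x|^2], near-optimality says that the squared distance of any [x] in
    [S] to [c] is at most the variance of the [p k], up to the slack in the strict hypothesis. That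
    variance is half the weighted mean of the squared pairwise distances. *)
Lemma jung m (S : set 'rV[R]_m) (D rho : R) :
  S !=set0 -> (forall x y, S x -> S y -> enorm (x - y) <= D) -> 0 <= rho ->
  D ^+ 2 / 2 * (1 - m.+1%:R^-1) < rho ^+ 2 -> exists c, S `<=` eball c rho.
Proof.
move=> [x0 Sx0] SD rho0 hrho.
have D0 : 0 <= D by apply: le_trans (SD _ _ Sx0 Sx0); exact: enorm_ge0.
have SB x : S x -> enorm x <= enorm x0 + D.
  move=> Sx; rewrite -(subrK x0 x) addrC; apply: le_trans (enormD _ _) _.
  by rewrite lerD2l SD.
have Sb x : S x -> - (enorm x0 + D) ^+ 2 <= - dotv x x.
  by move=> Sx; rewrite lerN2 -enorm_leP ?SB// addr_ge0// enorm_ge0.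
have e0 : 0 < rho ^+ 2 - D ^+ 2 / 2 * (1 - m.+1%:R^-1) by rewrite subr_gt0.
have [lam [p [c [lamw Sp cE hmin]]]] :=
  near_min_config ler01 (ex_intro _ _ Sx0) SB Sb e0.
exists c => x Sx; rewrite /eball/= enorm_leP//.
have := hmin _ Sx; under eq_bigr do rewrite mulrN; rewrite sumrN.
have := variance_pairs p lamw; rewrite /= -cE.
set V := \sum_k lam k * dotv (p k) (p k) => vp.
have : \sum_k \sum_l lam k * lam l * dotv (p k - p l) (p k - p l) <=
    D ^+ 2 * (1 - m.+1%:R^-1).
  (* Diagonal pairs contribute nothing, so only the weight [1 - \sum_k lam k ^+ 2] of the pairs with
     [k != l] counts. *)
  apply: (@le_trans _ _ (D ^+ 2 * (1 - \sum_k lam k ^+ 2))); last first.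
    by rewrite ler_wpM2l ?sqr_ge0// lerD2l lerN2 weights_sq_ge.
  have [lam0 lam1] := lamw.
  rewrite -{1}lam1 -sumrB mulr_sumr; apply: ler_sum => k _.
  rewrite (bigD1 k)//= subrr dotv0l mulr0 add0r.
  have -> : lam k - lam k ^+ 2 = \sum_(l | l != k) lam k * lam l.
    rewrite -mulr_sumr; move: lam1; rewrite (bigD1 k)//= => lam1.
    have -> : \sum_(l | l != k) lam l = 1 - lam k by rewrite -lam1; ring.
    ring.
  rewrite mulr_sumr; apply: ler_sum => l _; rewrite mulrC ler_wpM2r ?mulr_ge0//.
  by rewrite -enorm_leP// SD.
rewrite vp !dotv_lin (dotvC x c).
set q := _^-1; set cc := dotv c c; set xx := dotv x x; set cx := dotv c x.
lra.
Qed.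

End Jung.

(** * Compactness and separation in the Euclidean norm *)

Section Compactness.
Variable R : realType.

Lemma mx_norm_le_enorm n (x : 'rV[R]_n) : `|x| <= enorm x.
Proof.
rewrite [leLHS]/Num.norm/= mx_normrE; apply/bigmax_leP; split => [|[i j] _ /=].
  exact: enorm_ge0.
rewrite (ord1 i) -(@ler_pXn2r _ 2) ?nnegrE ?enorm_ge0// enorm_sq.
rewrite real_normK ?num_real// /dotv (bigD1 j)//= -expr2 lerDl.
by apply: sumr_ge0 => k _; rewrite -expr2 sqr_ge0.
Qed.

Lemma continuous_dotvv n : continuous (fun x : 'rV[R]_n => dotv x x).
Proof.
apply: continuous_big => [|i _ x]; first exact: add_continuous.
by apply: continuousM; exact: coord_continuous.
Qed.

Lemma continuous_enorm n : continuous (@enorm R n).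
Proof.
move=> x; apply: (@continuous_comp _ _ _ (fun x => dotv x x)).
  exact: continuous_dotvv.
exact: sqrt_continuous.
Qed.

Lemma continuous_enorm_dist n (x : 'rV[R]_n) :
  continuous (fun y : 'rV[R]_n => enorm (x - y)).
Proof.
move=> y; apply: (@continuous_comp _ _ _ (fun y : 'rV[R]_n => x - y)).
  apply: (@continuousB _ 'rV[R]_n _ (cst x) id); last exact: cvg_id.
  exact: cst_continuous.
exact: continuous_enorm.
Qed.

Lemma near_enorm n (x : 'rV[R]_n) e : 0 < e -> \forall y \near x, enorm (x - y) < e.
Proof.
move=> e0; apply: (@continuous_enorm_dist n x x [set r | r < e]).
by apply: lt_nbhsl; rewrite subrr enorm0.
Qed.

Lemma lipschitz_continuous n (V : normedModType R) (f : 'rV[R]_n -> V) L :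
  (forall x y, `|f x - f y| <= L * enorm (x - y)) -> continuous f.
Proof.
move=> fL x A /nbhs_ballP[e /= e0 eA].
have L0 : 0 < `|L| + 1 by rewrite ltr_pwDr.
have eL : 0 < e / (`|L| + 1) by rewrite divr_gt0.
apply: (@filterS _ _ (@nbhs_filter 'rV[R]_n x) _ _ _ (near_enorm x eL)) => y /=.
rewrite ltr_pdivlMr// mulrC => xy; apply: eA; rewrite -ball_normE/=.
apply: le_lt_trans (fL _ _) _; apply: le_lt_trans xy.
by rewrite ler_wpM2r ?enorm_ge0// (le_trans (ler_norm _))// lerDl.
Qed.

Lemma compact_argmin n (C : set 'rV[R]_n) (f : 'rV[R]_n -> R) :
  C !=set0 -> compact C -> continuous f ->
  exists2 c, C c & forall x, C x -> f c <= f x.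
Proof.
move=> C0 cC cf.
have [c /set_mem Cc cmin] := EVT_min_rV C0 cC (continuous_subspaceT cf).
by exists c => // x Cx; apply: cmin; exact/mem_set.
Qed.

Lemma compact_enorm_bounded n (C : set 'rV[R]_n) :
  compact C -> exists2 B, 0 <= B & forall x, C x -> enorm x <= B.
Proof.
move=> cC; have [C0|C0] := pselect (C !=set0); last first.
  by exists 0 => // x Cx; case: C0; exists x.
have [c _ cmax] := EVT_max_rV C0 cC (continuous_subspaceT (@continuous_enorm n)).
by exists (enorm c) => [|x Cx]; [exact: enorm_ge0 | exact/cmax/mem_set].
Qed.

Lemma compact_sphere n : compact [set u : 'rV[R]_n | enorm u = 1].
Proof.
apply: bounded_closed_compact.
  exists 1; split => // M M1 u /= u1; apply: le_trans (mx_norm_le_enorm _) _.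
  by rewrite u1 ltW.
apply: (@preimage_closed _ _ (@enorm R n) [set x | x = 1]); last exact: closed_eq.
by move=> x _; exact: continuous_enorm.
Qed.

Lemma compact_mulmx m n (C : set 'rV[R]_m) (A : 'M[R]_(m, n)) :
  compact C -> compact ((fun x => x *m A) @` C).
Proof.
apply: continuous_compact; apply: continuous_subspaceT.
pose L := \sum_i \sum_j `|A i j|.
apply: (@lipschitz_continuous _ _ _ L) => x y; rewrite -mulmxBl.
set z := x - y.
rewrite [leLHS]/Num.norm/= mx_normrE; apply/bigmax_leP; split => [|[i j] _ /=].
  by rewrite mulr_ge0 ?enorm_ge0//; do 2![apply: sumr_ge0 => ? _].
rewrite mxE; apply: le_trans (ler_norm_sum _ _ _) _; rewrite mulr_suml.
apply: ler_sum => k _; rewrite normrM mulrC ler_pM//.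
  by rewrite (bigD1 j)//= lerDl; apply: sumr_ge0.
apply: le_trans (mx_norm_le_enorm z).
rewrite [leRHS]/Num.norm/= mx_normrE (ord1 i).
by apply: (le_bigmax _ (fun ij : 'I_1 * 'I_m => `|z ij.1 ij.2|) (0, k)).
Qed.

Lemma compact_sub n (C : set 'rV[R]_n) :
  compact C -> compact [set x | exists a b, [/\ C a, C b & x = a - b]].
Proof.
move=> cC; have -> : [set x | exists a b, [/\ C a, C b & x = a - b]] =
    (fun z : 'rV[R]_n * 'rV[R]_n => z.1 - z.2) @` (C `*` C).
  apply/seteqP; split => [x [a [b [Ca Cb ->]]]|_ [[a b] [/= Ca Cb] <-]].
    by exists (a, b).
  by exists a, b.
apply: continuous_compact; last exact: compact_setX.
by apply: continuous_subspaceT; exact: sub_continuous.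
Qed.

End Compactness.

(** * Convex sets and separation *)

Section Convexity.
Variable R : realType.

Lemma convex_setP n (C : set 'rV[R]_n) :
  convex_set C <->
  forall x y t, 0 <= t -> t <= 1 -> C x -> C y -> C (t *: x + (1 - t) *: y).
Proof.
split=> [cC x y t t0 t1 Cx Cy|cC x y t /set_mem Cx /set_mem Cy].
  have t01 : Itv.spec (@Itv.num_sem R) (Itv.Real `[0%Z, 1%Z]) t.
    by rewrite /Itv.spec/= /Itv.num_sem num_real/= in_itv/= t0.
  by have /set_mem := cC x y (Itv.mk t01) (mem_set Cx) (mem_set Cy).
by apply/mem_set; apply: cC.
Qed.

Lemma convex_mean n (C : set 'rV[R]_n) N (x : 'I_N.+1 -> 'rV[R]_n) :
  convex_set C -> (forall k, C (x k)) -> C (N.+1%:R^-1 *: \sum_k x k).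
Proof.
move=> /convex_setP cC; elim: N x => [|N IH] x Cx.
  by rewrite big_ord1 invr1 scale1r.
have nz k : k.+1%:R != 0 :> R by rewrite pnatr_eq0.
rewrite big_ord_recl scalerDr.
have -> : N.+2%:R^-1 *: \sum_(i < N.+1) x (lift ord0 i) =
    (1 - N.+2%:R^-1) *: (N.+1%:R^-1 *: \sum_(i < N.+1) x (lift ord0 i)).
  rewrite scalerA; congr (_ *: _).
  have -> : 1 - N.+2%:R^-1 = N.+1%:R / N.+2%:R :> R.
    apply: (mulIf (nz N.+1)); rewrite mulrBl mul1r mulVf// -mulrA mulVf// mulr1.
    by rewrite -[N.+2]addn1 natrD addrK.
  by rewrite mulrAC mulfV// mul1r.
apply: cC; rewrite ?invr_ge0// ?invf_le1 ?ler1n ?ltr0n//.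
exact: IH.
Qed.

Lemma convex_mulmx m n (C : set 'rV[R]_m) (A : 'M[R]_(m, n)) :
  convex_set C -> convex_set ((fun x => x *m A) @` C).
Proof.
move=> /convex_setP cC; apply/convex_setP => _ _ t t0 t1 [x Cx <-] [y Cy <-].
by exists (t *: x + (1 - t) *: y); [exact: cC | rewrite mulmxDl -!scalemxAl].
Qed.

Lemma convex_sub n (C : set 'rV[R]_n) :
  convex_set C -> convex_set [set x | exists a b, [/\ C a, C b & x = a - b]].
Proof.
move=> /convex_setP cC; apply/convex_setP.
move=> _ _ t t0 t1 [a [b [Ca Cb ->]]] [a' [b' [Ca' Cb' ->]]].
exists (t *: a + (1 - t) *: a'), (t *: b + (1 - t) *: b').
by split; [exact: cC | exact: cC |]; rewrite !scalerBr addrACA -opprD.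
Qed.

(** [v] points from the nearest point [z] of [C] to [x]; were [dotv v (y - z)] positive, a small
    step from [z] towards [y] would come closer to [x]. *)
Lemma separation n (C : set 'rV[R]_n) x :
  C !=set0 -> compact C -> convex_set C -> ~ C x ->
  exists2 v, v != 0 & forall y, C y -> dotv y v <= dotv x v - dotv v v.
Proof.
move=> C0 cC /convex_setP vC nCx.
have [z Cz zmin] := compact_argmin C0 cC (@continuous_enorm_dist _ n x).
pose v := x - z.
have v0 : v != 0 by apply/eqP => /subr0_eq xz; apply: nCx; rewrite xz.
exists v => // y Cy.
suff : dotv v (y - z) <= 0.
  have -> : dotv v v = dotv x v - dotv z v by rewrite {1}/v dotvDl dotvNl.
  rewrite dotvDr dotvNr (dotvC v y) (dotvC v z); lra.
rewrite leNgt; apply/negP => d0; set d := dotv v (y - z) in d0.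
have yz : 0 < dotv (y - z) (y - z).
  by rewrite dotv_gt0; apply: contraL d0 => /eqP; rewrite /d => ->; rewrite dotv0r ltxx.
set q := dotv (y - z) (y - z) in yz.
pose t := Num.min 1 (d / q).
have t0 : 0 < t by rewrite lt_min ltr01 divr_gt0.
have t1 : t <= 1 by rewrite ge_min lexx.
have tq : t * q <= d by rewrite -ler_pdivlMr// ge_min lexx orbT.
have := zmin _ (vC y z t (ltW t0) t1 Cy Cz).
have -> : x - (t *: y + (1 - t) *: z) = v - t *: (y - z).
  by apply/rowP => j; rewrite !mxE; ring.
rewrite enorm_leP ?enorm_ge0// enorm_sq -/v.
have -> (u w : 'rV[R]_n) : dotv (u - t *: w) (u - t *: w) =
    dotv u u - t * (2 * dotv u w - t * dotv w w).
  by rewrite !dotv_lin (dotvC w u); ring.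
rewrite -/d -/q => h.
have : t * (2 * d - t * q) <= 0 by lra.
rewrite pmulr_rle0//; lra.
Qed.

End Convexity.

(** * Support functions and width *)

Section Width.
Variable R : realType.

Definition supp n (C : set 'rV[R]_n) v := sup [set dotv x v | x in C].

Section Support.
Variables (n : nat) (C : set 'rV[R]_n) (B : R).
Hypotheses (C0 : C !=set0) (CB : forall x, C x -> enorm x <= B).
Implicit Types v w : 'rV[R]_n.

Lemma dotv_le_bound x v : C x -> dotv x v <= B * enorm v.
Proof.
by move=> Cx; apply: le_trans (dotv_le _ _) _; rewrite ler_wpM2r ?enorm_ge0 ?CB.
Qed.

Lemma supp_ge x v : C x -> dotv x v <= supp C v.
Proof.
move=> Cx; apply: ub_le_sup; last by exists x.
by exists (B * enorm v) => _ [y Cy <-]; exact: dotv_le_bound.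
Qed.

Lemma supp_le v b : (forall x, C x -> dotv x v <= b) -> supp C v <= b.
Proof.
move=> h; apply: ge_sup => [|_ [y Cy <-]]; last exact: h.
by case: C0 => x Cx; exists (dotv x v), x.
Qed.

Lemma supp_lower v : - (B * enorm v) <= supp C v.
Proof.
case: C0 => x Cx; apply: le_trans (supp_ge v Cx).
by rewrite lerNl -dotvNr -(enormN v) dotv_le_bound.
Qed.

Lemma supp_lip v w : supp C v <= supp C w + B * enorm (v - w).
Proof.
apply: supp_le => x Cx; rewrite -{1}(subrK w v) addrC dotvDr.
by rewrite lerD ?supp_ge ?dotv_le_bound.
Qed.

Lemma supp_homo a v : 0 < a -> a * supp C v <= supp C (a *: v).
Proof.
move=> a0; rewrite mulrC -ler_pdivlMr//; apply: supp_le => x Cx.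
by rewrite ler_pdivlMr// mulrC -dotvZr supp_ge.
Qed.

Hypotheses (cC : compact C) (vC : convex_set C).

(** At the unit normal separating [C] from a point outside it, a ball containing that point would
    exceed the support function. *)
Lemma eball_subset z r :
  (forall u, enorm u = 1 -> dotv z u + r <= supp C u) -> eball z r `<=` C.
Proof.
move=> h y yr; apply: contrapT => /(separation C0 cC vC)[v v0 vsep].
have nv : 0 < enorm v by rewrite enorm_gt0.
have vv : 0 < dotv v v by rewrite dotv_gt0.
set u := (enorm v)^-1 *: v.
have u1 : enorm u = 1 by exact: enorm_normalize.
have vu : v = enorm v *: u by rewrite scalerA mulfV ?scale1r ?gt_eqF.
have h1 : supp C v <= dotv y v - dotv v v by exact: supp_le.
have h2 : enorm v * supp C u <= supp C v by rewrite {2}vu; exact: supp_homo.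
have h3 : dotv y u <= supp C u.
  apply: le_trans (h _ u1); rewrite -lerBlDl -dotvNl -dotvDl.
  by apply: le_trans (dotv_le _ _) _; rewrite u1 mulr1.
have h4 : dotv y v = enorm v * dotv y u by rewrite {1}vu dotvZr.
have : enorm v * dotv y u <= enorm v * supp C u by rewrite ler_pM2l.
lra.
Qed.

End Support.

(** Each sign makes the cross term with the partial sum nonnegative, so the squared norms at least
    add up. *)
Lemma greedy_signs m N (y : 'I_N -> 'rV[R]_m) s : exists eps : 'I_N -> bool,
  let w := s + \sum_k (-1) ^+ eps k *: y k in
  dotv s s + \sum_k dotv (y k) (y k) <= dotv w w.
Proof.
elim: N y s => [|N IH] y s.
  by exists (fun=> false); rewrite !big_ord0 !addr0.
pose b := dotv s (y ord0) < 0.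
have [eps h] := IH (fun k => y (lift ord0 k)) (s + (-1) ^+ b *: y ord0).
exists (fun k => oapp eps b (unlift ord0 k)) => /=.
rewrite !big_ord_recl unlift_none/=; under [in leRHS]eq_bigr do rewrite liftK/=.
rewrite !addrA; apply: le_trans h.
rewrite lerD2r !dotv_lin mulrA -expr2 sqrr_sign mul1r (dotvC (y ord0) s).
suff : 0 <= (-1) ^+ b * dotv s (y ord0) by lra.
rewrite /b; case: ltP => h; rewrite ?mul1r// mulN1r oppr_ge0 ltW//.
Qed.

(* A weak form of Steinhagen's inequality: the optimality conditions for the
   inscribed ball give unit normals [p_k] with mean nearly 0 and
   [sum lam_k supp p_k] at most about the inradius.  A signed sum of the
   [lam_k p_k] of norm at least [1 / sqrt (m + 2)] is a direction of small
   width. *)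
Lemma weak_steinhagen m (C : set 'rV[R]_m.+1) rho0 rho :
  C !=set0 -> compact C -> convex_set C ->
  (forall c r, 0 <= r -> eball c r `<=` C -> r <= rho0) -> rho0 < rho ->
  exists u b, enorm u = 1 /\
    forall x, C x -> `|dotv x u - b| <= Num.sqrt m.+2%:R * rho.
Proof.
move=> C0 cC vC hrho0 rho0rho.
have [B B0 CB] := compact_enorm_bounded cC.
have rho0_ge0 : 0 <= rho0.
  case: C0 => x Cx; apply: (hrho0 x) => // y; rewrite /eball/= => yx.
  suff -> : y = x by [].
  by apply: subr0_eq; apply/eqP; rewrite -enorm_eq0 eq_le yx enorm_ge0.
pose eta := (rho - rho0) / 2.
have eta0 : 0 < eta by rewrite divr_gt0 ?subr_gt0.
(* This [a] gives [B * |c| <= 2 * a * |c|^2 + eta] for every [c], by completing the square. *)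
pose a := B ^+ 2 / (8 * eta).
have a0 : 0 <= a by rewrite divr_ge0 ?sqr_ge0// mulr_ge0// ltW.
have S0 : [set u : 'rV[R]_m.+1 | enorm u = 1] !=set0.
  by have [u u1] := unit_vector_exists R m; exists u.
have SB u : [set u : 'rV[R]_m.+1 | enorm u = 1] u -> enorm u <= 1 by move=> ->.
have Sb u : [set u : 'rV[R]_m.+1 | enorm u = 1] u -> - B <= supp C u.
  by move=> u1; apply: le_trans (supp_lower C0 CB u); rewrite u1 mulr1.
have [lam [p [c [lamw p1 cE hmin]]]] := near_min_config a0 S0 SB Sb eta0.
set G := \sum_k lam k * supp C (p k) in hmin.
set cc := dotv c c in hmin.
(* A nonnegative left side is the radius of a ball about [- (2 * a) *: c] that the optimality
   condition places inside [C]. *)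
have hG : G + 2 * a * cc - eta <= rho0.
  have [r0|/ltW r0] := leP 0 (G + 2 * a * cc - eta); last exact: le_trans r0 _.
  apply: (hrho0 (- (2 * a) *: c)) => //.
  apply: (eball_subset C0 CB cC vC) => u u1.
  have := hmin _ u1; rewrite dotvZl; lra.
have [eps] := greedy_signs (fun k => lam k *: p k) c.
set w := c + _ => /= hw.
have [lam0 lam1] := lamw.
(* Dimension [m.+1] gives [m.+2] weighted points, hence the constant. *)
have ww : m.+2%:R^-1 <= dotv w w.
  apply: le_trans hw; apply: le_trans (weights_sq_ge lamw) _.
  apply: (@le_trans _ _ (\sum_k dotv (lam k *: p k) (lam k *: p k))).
    apply: ler_sum => k _; rewrite dotvZl dotvZr mulrA -expr2.
    by rewrite -(enorm_sq (p k)) p1 expr1n mulr1.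
  by rewrite lerDr dotv_ge0.
pose T := \sum_k (-1) ^+ eps k * (lam k * supp C (p k)).
pose Bc := B * enorm c.
(* Both [w] and [2 *: c - w] are combinations of the [p k] with nonnegative coefficients, so support
   values bound [dotv x] on them by [G + T] and [G - T]; [Bc] accounts for [dotv x c]. *)
have hx x : C x -> `|dotv x w - (T - Bc)| <= G + Bc.
  move=> Cx.
  have xc : dotv x c = \sum_k lam k * dotv x (p k).
    by rewrite cE dotv_sumr; apply: eq_bigr => k _; rewrite dotvZr.
  have xw : dotv x w = dotv x c + \sum_k (-1) ^+ eps k * (lam k * dotv x (p k)).
    rewrite dotvDr dotv_sumr; congr (_ + _).
    by apply: eq_bigr => k _; rewrite !dotvZr.
  have le_g k : lam k * dotv x (p k) <= lam k * supp C (p k).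
    by rewrite ler_wpM2l// (supp_ge CB).
  have hup : dotv x w <= G + T.
    rewrite xw xc /G /T -!big_split/=; apply: ler_sum => k _.
    have := le_g k; case: (eps k); rewrite ?expr0 ?expr1; lra.
  have hlow : dotv x c - \sum_k (-1) ^+ eps k * (lam k * dotv x (p k)) <= G - T.
    rewrite xc /G /T -!sumrB; apply: ler_sum => k _.
    have := le_g k; case: (eps k); rewrite ?expr0 ?expr1; lra.
  have hc : - Bc <= dotv x c.
    by rewrite lerNl -dotvNr /Bc -(enormN c) (dotv_le_bound CB).
  have Bc0 : 0 <= Bc by rewrite mulr_ge0 ?enorm_ge0.
  rewrite ler_norml; lra.
have hrho : G + Bc <= rho.
  have e : rho = rho0 + 2 * eta by rewrite /eta; field.
  suff : Bc <= 2 * a * cc + eta by lra.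
  rewrite -subr_ge0 /cc -enorm_sq /Bc.
  have -> : 2 * a * enorm c ^+ 2 + eta - B * enorm c =
      (B * enorm c - 2 * eta) ^+ 2 / (4 * eta).
    by rewrite /a; field; rewrite gt_eqF.
  by rewrite divr_ge0 ?sqr_ge0// mulr_ge0// ltW.
have m0 : 0 < m.+2%:R :> R by rewrite ltr0n.
have dw : 0 < dotv w w by apply: lt_le_trans ww; rewrite invr_gt0.
have nw : 0 < enorm w by rewrite enorm_gt0 -dotv_gt0.
exists ((enorm w)^-1 *: w), ((enorm w)^-1 * (T - Bc)); split.
  by apply: enorm_normalize; rewrite -enorm_gt0.
move=> x Cx; rewrite dotvZr -mulrBr normrM ger0_norm ?invr_ge0 ?enorm_ge0//.
apply: ler_pM => //; first by rewrite invr_ge0 ltW.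
  rewrite -[leRHS]invrK lef_pV2 ?posrE ?invr_gt0 ?sqrtr_gt0//.
  by rewrite -(sqrtrV (ltW m0)) /enorm ler_sqrt ?dotv_ge0.
exact: le_trans (hx _ Cx) hrho.
Qed.

End Width.

(** * Orthogonal complements and directions of small width *)

Section OrthogonalComplement.
Variable R : realType.

(* The Householder reflection exchanging [u] and the first basis vector is an
   orthogonal matrix with first row [u]. *)
Lemma orthonormal_completion n (u : 'rV[R]_n.+1) : enorm u = 1 ->
  exists Q : 'M[R]_(n, n.+1),
    [/\ Q *m Q^T = 1%:M, u *m Q^T = 0 & u^T *m u + Q^T *m Q = 1%:M].
Proof.
move=> u1.
have uu : dotv u u = 1 by rewrite -enorm_sq u1 expr1n.
suff [H HH uH] : exists2 H : 'M[R]_(1 + n), H *m H^T = 1%:M & usubmx H = u.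
  have HE : H = col_mx u (dsubmx H) by rewrite -uH vsubmxK.
  have HH' := mulmx1C HH.
  rewrite HE tr_col_mx in HH HH'; exists (dsubmx H); split.
  - have := congr1 (@drsubmx _ 1 n 1 n) HH.
    by rewrite mul_col_row block_mxKdr scalar_mx_block block_mxKdr.
  - have := congr1 (@ursubmx _ 1 n 1 n) HH.
    by rewrite mul_col_row block_mxKur scalar_mx_block block_mxKur.
  - by rewrite mul_row_col in HH'.
pose e : 'rV[R]_n.+1 := delta_mx 0 0.
have eE v : dotv e v = v 0 0.
  rewrite /dotv (bigD1 0)//= big1 => [|j /negPf j0]; rewrite !mxE ?eqxx ?mul1r ?addr0//.
  by rewrite j0 mul0r.
have ee : dotv e e = 1 by rewrite eE mxE !eqxx.
have usubE (H : 'M[R]_(1 + n)) : usubmx H = e *m H.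
  apply/rowP => j; rewrite [LHS]mxE -rowE mxE; congr (H _ _); exact: val_inj.
have [ue|ue] := eqVneq u e.
  by exists 1%:M; rewrite ?trmx1 ?mulmx1// usubE mulmx1 ue.
pose w := u - e; pose q := dotv w w.
have q0 : q != 0 by rewrite dotv_eq0 subr_eq0.
have wwE : w *m w^T = q%:M by rewrite [LHS]mx11_scalar -dotvE.
pose H : 'M[R]_(1 + n) := 1%:M - (2 / q) *: (w^T *m w).
have Ht : H^T = H.
  by rewrite /H linearB/= linearZ/= trmx1 trmx_mul trmxK.
have HHP (P : 'M[R]_(1 + n)) : P *m P = q *: P ->
    (1%:M - (2 / q) *: P) *m (1%:M - (2 / q) *: P) = 1%:M.
  move=> PP; rewrite mulmxBl mul1mx mulmxBr mulmx1 -scalemxAl -scalemxAr PP.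
  by apply/matrixP => i j; rewrite !mxE; field.
exists H.
  by rewrite Ht; apply: HHP; rewrite -mulmxA (mulmxA w) wwE mul_scalar_mx -scalemxAr.
rewrite usubE /H mulmxBr mulmx1 -scalemxAr mulmxA.
rewrite [e *m w^T]mx11_scalar -dotvE mul_scalar_mx scalerA.
(* As [u] and [e] are unit vectors, [2 * dotv e w = - |w|^2], so the reflection sends [e] to
   [e + w = u]. *)
have -> : 2 / q * dotv e w = -1.
  have ew : 2 * dotv e w = - q.
    by rewrite /q /w !dotv_lin uu ee (dotvC u e); ring.
  by rewrite mulrAC ew mulNr mulfV.
by rewrite scaleN1r opprK /w addrC subrK.
Qed.

(** Induction on the rows of [B]: within the complement [U] of the other rows, [y] holds the
    coordinates of the projected first row, and [Q] cuts out a hyperplane orthogonal to it. *)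
Lemma orthogonal_complement k m n (B : 'M[R]_(k, n)) : n = (k + m)%N ->
  exists U : 'M[R]_(m, n), U *m U^T = 1%:M /\ U *m B^T = 0.
Proof.
elim: k m n B => [m n B nE|k IH m n].
  rewrite add0n in nE; subst n.
  exists 1%:M; rewrite trmx1 mulmx1; split => //.
  by rewrite [LHS]thinmx0.
rewrite -[k.+1]add1n => B nE.
have [U [UU UB]] := IH m.+1 n (dsubmx B) (etrans nE (addSnnS _ _)).
pose y := usubmx B *m U^T.
have [u [u1 uy]] : exists u, enorm u = 1 /\ exists a, y = a *: u.
  have [y0|y0] := eqVneq y 0.
    have [u u1] := unit_vector_exists R m; exists u; split => //.
    by exists 0; rewrite scale0r.
  exists ((enorm y)^-1 *: y); split; first exact: enorm_normalize.
  by exists (enorm y); rewrite scalerA mulfV ?scale1r ?enorm_eq0.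
have [Q [QQ uQ _]] := orthonormal_completion u1.
exists (Q *m U); split.
  by rewrite trmx_mul mulmxA -(mulmxA Q) UU mulmx1.
rewrite -[B in B^T]vsubmxK tr_col_mx mul_mx_row -[_ *m (dsubmx B)^T]mulmxA UB mulmx0.
have -> : Q *m U *m (usubmx B)^T = (y *m Q^T)^T.
  by rewrite !trmx_mul !trmxK mulmxA.
have [a ->] := uy; rewrite -scalemxAl uQ scaler0 trmx0.
exact: row_mx0.
Qed.

End OrthogonalComplement.

(** * Minimal width and flat directions *)

Section FlatDirections.
Variable R : realType.

(** [supp M] is the width function of [C]. At a minimizer [u] the point [w *: u] lies in [M], since
    a vector separating it from [M] would be a direction of smaller width; so [C] has a chord of
    length [w] along [u]. *)
Lemma min_width n (C : set 'rV[R]_n.+1) :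
  C !=set0 -> compact C -> convex_set C -> exists u w a,
  [/\ enorm u = 1, C a /\ C (a + w *: u),
      forall x, C x -> 0 <= dotv (x - a) u <= w &
      forall v b h, enorm v = 1 -> (forall x, C x -> `|dotv x v - b| <= h) ->
        w <= 2 * h].
Proof.
move=> C0 cC vC.
set M := [set x | exists a b, [/\ C a, C b & x = a - b]].
have M0 : M !=set0 by case: C0 => x Cx; exists (x - x), x, x.
have cM : compact M by exact: compact_sub.
have vM : convex_set M by exact: convex_sub.
have [B B0 MB] := compact_enorm_bounded cM.
have cont : continuous (supp M).
  apply: (@lipschitz_continuous _ _ R^o _ B) => x y.
  have := supp_lip M0 MB x y; have := supp_lip M0 MB y x.
  rewrite (enorm_subC y) ler_norml; lra.
have S0 : [set u : 'rV[R]_n.+1 | enorm u = 1] !=set0.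
  by have [u u1] := unit_vector_exists R n; exists u.
have [u u1 umin] := compact_argmin S0 (@compact_sphere R n.+1) cont.
rewrite /= in u1; set w := supp M u in umin.
have [a [b [Ca Cb wE]]] : M (w *: u).
  apply: contrapT => /(separation M0 cM vM)[v v0 vsep].
  have nv : 0 < enorm v by rewrite enorm_gt0.
  have vv : 0 < dotv v v by rewrite dotv_gt0.
  have h1 : supp M v <= dotv (w *: u) v - dotv v v by exact: supp_le.
  have h2 := umin _ (enorm_normalize v0).
  have h3 : enorm v * supp M ((enorm v)^-1 *: v) <= supp M v.
    have e : v = enorm v *: ((enorm v)^-1 *: v).
      by rewrite scalerA mulfV ?scale1r ?gt_eqF.
    by rewrite [X in _ <= supp M X]e; exact: (supp_homo M0 MB).
  have h4 : enorm v * w <= enorm v * supp M ((enorm v)^-1 *: v) by rewrite ler_pM2l.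
  have w0 : 0 <= w.
    have [x Cx] := C0; rewrite -(dotv0l u); apply: (supp_ge MB).
    by exists x, x; rewrite subrr.
  have := dotv_le u v; rewrite u1 mul1r => /(ler_wpM2l w0).
  move: h1; rewrite dotvZl; lra.
have aE : a = b + w *: u by rewrite wE addrC subrK.
have uu : dotv u u = 1 by rewrite -enorm_sq u1 expr1n.
have Mle x y : C x -> C y -> dotv (x - y) u <= w.
  by move=> Cx Cy; apply: (supp_ge MB); exists x, y.
exists u, w, b; split => //; first by rewrite -aE.
  move=> x Cx; rewrite Mle// andbT.
  have := Mle _ _ Ca Cx; rewrite aE !dotv_lin uu; lra.
move=> v c h v1 hv; apply: le_trans (umin _ v1) _.
apply: (supp_le M0) => _ [x [y [Cx Cy ->]]]; rewrite dotvDl dotvNl.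
have := hv _ Cx; have := hv _ Cy; rewrite !ler_norml; lra.
Qed.

Definition disc_in n i r (C : set 'rV[R]_n) :=
  exists (A : 'M[R]_(i, n)) c,
    A *m A^T = 1%:M /\ forall s, enorm s <= r -> C (c + s *m A).

(* [C] lies in a slab of thickness [w] orthogonal to [u] and contains a
   segment crossing it.  Averaging the points of [C] above a disc of the
   projection with suitable points of the segment puts them all at the same
   height. *)
Lemma disc_in_projection n i r (C : set 'rV[R]_n.+1) u w a (Q : 'M[R]_(n, n.+1)) :
  convex_set C -> C a -> C (a + w *: u) -> enorm u = 1 ->
  (forall x, C x -> 0 <= dotv (x - a) u <= w) ->
  Q *m Q^T = 1%:M -> u^T *m u + Q^T *m Q = 1%:M ->
  disc_in i r ((fun x => x *m Q^T) @` C) -> disc_in i (r / 2) C.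
Proof.
move=> /convex_setP vC Ca Caw u1 slab QQ uQ [A [c [AA disc]]].
have dec x : x = dotv x u *: u + x *m Q^T *m Q.
  rewrite -[LHS]mulmx1 -uQ mulmxDr !mulmxA; congr (_ + _).
  by rewrite [x *m u^T]mx11_scalar -dotvE mul_scalar_mx.
exists (A *m Q), ((dotv a u + w / 2) *: u + 2^-1 *: ((c + a *m Q^T) *m Q)); split.
  by rewrite trmx_mul mulmxA -(mulmxA A) QQ mulmx1.
move=> s sr.
(* [y] lies above the point with twice the displacement [s], which the averaging will halve. *)
have [y Cy /= yE] : ((fun x => x *m Q^T) @` C) (c + (2 *: s) *m A).
  apply: disc; rewrite enormZ ger0_norm//; lra.
set t := dotv (y - a) u.
have /andP[t0 tw] : 0 <= t <= w by exact: slab.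
(* Height [w - t] complements the height [t] of [y], so the midpoint has height [w / 2]. If [w = 0],
   the slab forces [t = 0]. *)
have Cz : C (a + (w - t) *: u).
  have [w0|w0] := eqVneq w 0.
    have -> : w - t = 0 by apply/eqP; rewrite eq_le; apply/andP; split; lra.
    by rewrite scale0r addr0.
  have wp : 0 < w by rewrite lt_def w0 (le_trans t0 tw).
  have -> : a + (w - t) *: u = (1 - t / w) *: (a + w *: u) + (1 - (1 - t / w)) *: a.
    by apply/rowP => j; rewrite !mxE; field.
  apply: vC => //; first by rewrite subr_ge0 ler_pdivrMr ?mul1r.
  by rewrite gerBl divr_ge0// ltW.
have /(_ _ _) := vC y (a + (w - t) *: u) 2^-1.
move=> /(_ _ _ Cy Cz) h.
suff -> : (dotv a u + w / 2) *: u + 2^-1 *: ((c + a *m Q^T) *m Q) + s *m (A *m Q) =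
    2^-1 *: y + (1 - 2^-1) *: (a + (w - t) *: u).
  by apply: h; lra.
have yu : dotv y u = dotv a u + t by rewrite /t dotvDl dotvNl; ring.
rewrite [in RHS](dec y) yE yu [X in (1 - 2^-1) *: (X + _)](dec a).
rewrite !mulmxDl -!scalemxAl -!mulmxA.
set X := c *m Q; set Y := a *m (Q^T *m Q); set Z := s *m (A *m Q).
by apply/rowP => j; rewrite !mxE; field.
Qed.

(* Repeatedly split off a direction of minimal width and project along it. *)
Lemma flat_directions i k (C : set 'rV[R]_(k + i.+1)) rho0 rho :
  C !=set0 -> compact C -> convex_set C ->
  (forall r, 0 <= r -> disc_in i.+1 r C -> r <= rho0) -> rho0 < rho ->
  exists (U : 'M[R]_(k.+1, k + i.+1)) b, U *m U^T = 1%:M /\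
    forall x l, C x -> `|(x *m U^T - b) 0 l| <= 2 ^+ k * (Num.sqrt i.+2%:R * rho).
Proof.
elim: k C rho0 rho => [|k IH] C rho0 rho C0 cC vC hC rho0rho.
  have [|u [b [u1 hu]]] := weak_steinhagen C0 cC vC _ rho0rho.
    move=> c r r0 cr; apply: hC => //; exists 1%:M, c; rewrite trmx1 mulmx1.
    by split => // s sr; apply: cr; rewrite /eball/= mulmx1 addrAC subrr add0r.
  exists u, (const_mx b); split.
    by rewrite [LHS]mx11_scalar -dotvE -enorm_sq u1 expr1n.
  move=> x l Cx; rewrite expr0 mul1r (ord1 l) !mxE.
  by have := hu x Cx; rewrite dotvE mxE.
have [u [w [a [u1 [Ca Caw] slab wmin]]]] := min_width C0 cC vC.
have [Q [QQ uQ uQ1]] := orthonormal_completion u1.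
(* Disc radii at most double under the projection, since a disc there yields a half-size disc in
   [C]. *)
have := IH ((fun x => x *m Q^T) @` C) (2 * rho0) (2 * rho).
case=> [||||| U [b [UU hU]]].
- by case: C0 => x Cx; exists (x *m Q^T), x.
- exact: compact_mulmx.
- exact: convex_mulmx.
- move=> r r0 /(disc_in_projection vC Ca Caw u1 slab QQ uQ1) d.
  have := hC (r / 2) _ d; rewrite divr_ge0// => /(_ isT); lra.
- lra.
set h := 2 ^+ k * _ in hU.
have hE : 2 ^+ k.+1 * (Num.sqrt i.+2%:R * rho) = h by rewrite /h exprS; ring.
rewrite hE.
pose V : 'M[R]_(1 + k.+1, (k + i.+1).+1) := col_mx u (U *m Q).
have VV : V *m V^T = 1%:M.
  rewrite /V tr_col_mx mul_col_row trmx_mul mulmxA uQ mul0mx.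
  rewrite -mulmxA -[Q *m u^T]trmxK trmx_mul trmxK uQ trmx0 mulmx0.
  rewrite !mulmxA -(mulmxA U) QQ mulmx1 UU.
  by rewrite [u *m u^T]mx11_scalar -dotvE -enorm_sq u1 expr1n -scalar_mx_block.
pose b' : 'rV[R]_(1 + k.+1) := row_mx (dotv a u + w / 2)%:M b.
suff hV x (l : 'I_(1 + k.+1)) : C x -> `|(x *m V^T - b') 0 l| <= h.
  by exists V, b'; split => // x l; exact: hV.
move=> Cx; rewrite /b'; have -> : x *m V^T = row_mx (x *m u^T) (x *m Q^T *m U^T).
  by rewrite /V tr_col_mx mul_mx_row trmx_mul mulmxA.
rewrite opp_row_mx add_row_mx.
(* A direction found in the projection lifts to one in which [C] has half-width at most [h], so by
   minimality the half-width along [u] obeys the same bound. *)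
have hw : w <= 2 * h.
  pose v := row ord0 (U *m Q).
  have vE x' : dotv x' v = (x' *m Q^T *m U^T) 0 ord0.
    by rewrite dotv_row trmx_mul mulmxA.
  apply: (wmin v (b 0 ord0)).
    rewrite /v row_mul enorm_isometry// /enorm dotv_row -row_mul UU.
    by rewrite !mxE eqxx sqrtr1.
  move=> x' Cx'; rewrite vE.
  by have := hU (x' *m Q^T) ord0; rewrite !mxE; apply; exists x'.
rewrite mxE; case: splitP => j _.
  rewrite (ord1 j) !mxE eqxx mulr1n.
  have -> : \sum_j x 0 j * u^T j 0 = dotv x u by rewrite dotvE mxE.
  have /andP := slab _ Cx; rewrite dotvDl dotvNl ler_norml => -[? ?]; lra.
by apply: hU; exists x.
Qed.

End FlatDirections.

(** * Gram determinants *)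

Section GramDeterminant.
Variable R : realType.

(** The squared volume of the parallelepiped spanned by the rows of [A]. *)
Definition gram k n (A : 'M[R]_(k, n)) := \det (A *m A^T).

Lemma gram_mulmx k n (T : 'M[R]_k) (A : 'M[R]_(k, n)) :
  gram (T *m A) = \det T ^+ 2 * gram A.
Proof. by rewrite /gram trmx_mul mulmxA -(mulmxA T) !det_mulmx det_tr; ring. Qed.

(** Base times height, squared: subtracting [c *m B] from the top row is a row operation of
    determinant 1 that makes the Gram matrix block diagonal. *)
Lemma gram_split k n (x : 'rV[R]_n) (B : 'M[R]_(k, n)) c :
  (x - c *m B) *m B^T = 0 ->
  gram (col_mx x B) = dotv (x - c *m B) (x - c *m B) * gram B.
Proof.
set q := x - c *m B => qB.
pose T : 'M[R]_(1 + k) := block_mx 1%:M (- c) 0 1%:M.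
have TA : T *m col_mx x B = col_mx q B.
  by rewrite /T mul_block_col !mul1mx mul0mx add0r mulNmx.
have detT : \det T = 1 by rewrite /T det_ublock !det1 mulr1.
rewrite -[LHS]mul1r -(expr1n _ 2) -detT -gram_mulmx TA /gram tr_col_mx mul_col_row.
rewrite qB -[B *m q^T]trmxK trmx_mul trmxK qB trmx0 det_ublock det_mx11.
by rewrite dotvE.
Qed.

Lemma gram_row_free k n (A : 'M[R]_(k, n)) : gram A != 0 -> row_free A.
Proof.
move=> gA; apply/row_freeP; exists (A^T *m invmx (A *m A^T)).
by rewrite mulmxA mulmxV// unitmxE unitfE.
Qed.

Lemma gram_bottom_neq0 k n (x : 'rV[R]_n) (B : 'M[R]_(k, n)) :
  gram (col_mx x B) != 0 -> gram B != 0.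
Proof.
move=> /gram_row_free Afree; apply/negP => /det0P[y y0 yBB].
have yB : y *m B = 0.
  by apply/eqP; rewrite -dotv_eq0 dotv_mulmx -mulmxA yBB dotv0r.
case/negP: y0.
have : row_mx 0 y *m col_mx x B = 0 *m col_mx x B :> 'M[R]_(1, n).
  by rewrite mul_row_col mul0mx yB addr0 mul0mx.
by move=> /(row_free_inj Afree) /(congr1 rsubmx); rewrite row_mxKr => ->; rewrite linear0.
Qed.

Lemma gram_bounded k n B : 0 <= B -> exists b, forall A : 'M[R]_(k, n),
  (forall l, enorm (row l A) <= B) -> gram A <= b.
Proof.
move=> B0; exists (\sum_(s : 'S_k) \prod_(l < k) (B * B)) => A AB.
apply: ler_sum => s _; apply: le_trans (ler_norm _) _.
rewrite normrM normrX normrN1 expr1n mul1r normr_prod.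
apply: ler_prod => l _; rewrite normr_ge0/=.
have -> : (A *m A^T) l (s l) = dotv (row l A) (row (s l) A).
  by rewrite dotv_row -row_mul [RHS]mxE.
by apply: le_trans (dotv_abs_le _ _) _; apply: ler_pM; rewrite ?enorm_ge0.
Qed.

(** The factor [kappa] leaves room for an actual matrix to come close enough to the supremum. *)
Lemma near_max_gram k n (M : set 'rV[R]_n) B kappa (A0 : 'M[R]_(k, n)) :
  0 <= B -> (forall x, M x -> enorm x <= B) -> 1 < kappa ->
  (forall l, M (row l A0)) -> 0 < gram A0 ->
  exists A : 'M[R]_(k, n), [/\ forall l, M (row l A), 0 < gram A &
    forall A' : 'M[R]_(k, n), (forall l, M (row l A')) -> gram A' <= kappa * gram A].
Proof.
move=> B0 MB kappa1 MA0 gA0.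
pose E := [set r | exists2 A : 'M[R]_(k, n), (forall l, M (row l A)) & r = gram A].
have [b hb] := gram_bounded k n B0.
have Eub : has_ubound E by exists b => _ [A MA ->]; apply: hb => l; exact: MB.
have Esup : has_sup E by split => //; exists (gram A0), A0.
have s0 : 0 < sup E by apply: lt_le_trans gA0 _; apply: ub_le_sup => //; exists A0.
have kappa0 : 0 < kappa by rewrite (lt_trans ltr01).
have e0 : 0 < sup E - sup E / kappa by rewrite subr_gt0 ltr_pdivrMr// ltr_pMr.
have [_ [A MA ->]] := sup_adherent e0 Esup.
rewrite opprB addrC subrK => hA.
exists A; split => //; first by apply: lt_trans hA; rewrite divr_gt0.
move=> A' MA'; apply: (@le_trans _ _ (sup E)); first by apply: ub_le_sup => //; exists A'.
by rewrite mulrC -ler_pdivrMr// ltW.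
Qed.

(** Exchanging [v] for [x] scales the Gram determinant by the ratio of squared heights over the rows
    of [B]. Near-maximality thus bounds the height of every [x] in [M], and with it the projection
    along those rows. *)
Lemma near_max_top_row k m n (M : set 'rV[R]_n) kappa v (B : 'M[R]_(k, n)) :
  n = (k + m)%N -> M v -> (forall l, M (row l B)) -> 0 < gram (col_mx v B) ->
  (forall A' : 'M[R]_(1 + k, n), (forall l, M (row l A')) ->
    gram A' <= kappa * gram (col_mx v B)) ->
  exists (q : 'rV[R]_n) (U : 'M[R]_(m, n)),
    [/\ 0 < dotv q q, dotv q v = dotv q q, q *m B^T = 0, U *m U^T = 1%:M &
        forall x, M x -> dotv (x *m U^T) (x *m U^T) <= kappa * dotv q q].
Proof.
move=> nE Mv MB gA hmax.
have gB : gram B != 0 by apply: gram_bottom_neq0; rewrite gt_eqF//; exact: gA.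
pose c (x : 'rV[R]_n) := x *m B^T *m invmx (B *m B^T).
have qB x : (x - c x *m B) *m B^T = 0.
  by rewrite mulmxBl /c -!mulmxA mulVmx ?mulmx1 ?subrr// unitmxE unitfE.
have [U [UU UB]] := orthogonal_complement B nE.
pose q (x : 'rV[R]_n) := x - c x *m B.
have gE x : gram (col_mx x B) = dotv (q x) (q x) * gram B by exact: gram_split.
move: gA; rewrite gE => gA.
have gB0 : 0 < gram B.
  rewrite lt_def gB/= leNgt; apply/negP => gBn.
  by move: gA; rewrite ltNge mulr_ge0_le0 ?dotv_ge0// ltW.
exists (q v), U; split => //.
- by move: gA; rewrite pmulr_lgt0.
- by rewrite [RHS]dotvDr dotvNr (dotvC _ (c v *m B)) dotv_mulmx qB dotv0r subr0.
- exact: qB.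
- move=> x Mx; apply: (@le_trans _ _ (dotv (q x) (q x))).
    have -> : x *m U^T = q x *m U^T.
      rewrite mulmxBl -mulmxA -[B *m U^T]trmxK trmx_mul trmxK UB.
      by rewrite trmx0 mulmx0 subr0.
    by rewrite -(enorm_sq (q x)) -enorm_leP ?enorm_ge0// enorm_proj.
  rewrite -(ler_pM2r gB0) -mulrA -!gE; apply: hmax => l.
  rewrite -[l]splitK; case: (fintype.split l) => j /=.
    by rewrite rowKu (ord1 j) row_id.
  by rewrite rowKd.
Qed.

(** A row swap preserves the Gram determinant, so row [j] may be taken on top. Up to scaling, the
    [q] for the various [j] are dual to the rows of [A]. *)
Lemma near_max_row k m n (M : set 'rV[R]_n) kappa (A : 'M[R]_(k.+1, n)) j :
  n = (k + m)%N -> (forall l, M (row l A)) -> 0 < gram A ->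
  (forall A' : 'M[R]_(k.+1, n), (forall l, M (row l A')) -> gram A' <= kappa * gram A) ->
  exists (q : 'rV[R]_n) (U : 'M[R]_(m, n)),
    [/\ 0 < dotv q q, forall l, dotv q (row l A) = (l == j)%:R * dotv q q,
        U *m U^T = 1%:M &
        forall x, M x -> dotv (x *m U^T) (x *m U^T) <= kappa * dotv q q].
Proof.
move=> nE MA gA hmax.
pose A1 : 'M[R]_(1 + k, n) := xrow 0 j A.
have rA1 l : row l A1 = row (tperm 0 j l) A by apply/rowP => t; rewrite !mxE.
have gA1 : gram A1 = gram A.
  by rewrite /A1 xrowE gram_mulmx det_perm sqrr_sign mul1r.
have A1E : A1 = col_mx (usubmx A1) (dsubmx A1) by rewrite vsubmxK.
have [||||q [U [q0 qv qB UU hU]]] :=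
  @near_max_top_row k m n M kappa (usubmx A1) (dsubmx A1) nE.
- have -> : usubmx A1 = row 0 A1.
    by apply/rowP => t; rewrite !mxE; congr (A _ _); congr (tperm _ _ _); exact: val_inj.
  by rewrite rA1.
- move=> l; have -> : row l (dsubmx A1) = row (rshift 1 l) A1.
    by apply/rowP => t; rewrite !mxE.
  by rewrite rA1.
- by rewrite -A1E gA1.
- by rewrite -A1E gA1.
have hrow (l : 'I_(1 + k)) : dotv q (row l A1) = (l == 0)%:R * dotv q q.
  rewrite A1E -[l]splitK; case: (fintype.split l) => t /=.
    by rewrite rowKu (ord1 t) row_id qv (_ : lshift k 0 = 0) ?eqxx ?mul1r//; exact: val_inj.
  by rewrite rowKd dotv_row qB mxE mul0r.
exists q, U; split => // l.
have -> : row l A = row (tperm 0 j l) A1 by rewrite rA1 tpermK.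
have -> : (l == j) = (tperm 0 j l == 0).
  by rewrite (can2_eq (tpermK 0 j) (tpermK 0 j)) tpermL.
exact: hrow.
Qed.

End GramDeterminant.

(** * Successive radii *)

Section Radii.
Variable R : realType.

(** Small multiples of [k] basis vectors are differences of points near an interior point. *)
Lemma interior_gram_pos k n (K : set 'rV[R]_n) : (k <= n)%N -> interior K !=set0 ->
  exists2 A : 'M[R]_(k, n),
    forall l, exists a b, [/\ K a, K b & row l A = a - b] & 0 < gram A.
Proof.
move=> kn [x0 /nbhs_ballP[e /= e0 eK]].
have Kx x : enorm (x0 - x) < e -> K x.
  move=> xe; apply: eK; rewrite -ball_normE/=.
  exact: le_lt_trans (mx_norm_le_enorm _) xe.
pose r := e / 2; have r0 : 0 < r by rewrite divr_gt0.
pose P : 'M[R]_(k, n) := pid_mx k.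
have PP : P *m P^T = 1%:M by rewrite /P tr_pid_mx mul_pid_mx minnn (minn_idPr kn) pid_mx_1.
exists (r *: P) => [l|].
  exists (x0 + row l (r *: P)), x0; split; last by rewrite addrC addKr.
    apply: Kx; rewrite opprD addNKr enormN.
    have -> : row l (r *: P) = r *: row l P by apply/rowP => j; rewrite !mxE.
    rewrite enormZ ger0_norm ?ltW// /enorm dotv_row -row_mul PP !mxE eqxx sqrtr1.
    by rewrite mulr1 /r ltr_pdivrMr// ltr_pMr// ltr1n.
  by apply: Kx; rewrite subrr enorm0.
have -> : r *: P = r%:M *m P by rewrite mul_scalar_mx.
by rewrite gram_mulmx /gram PP det1 mulr1 det_scalar !exprn_gt0.
Qed.

(* For [k + 1] difference vectors of [K] spanning nearly maximal volume,
   [K] contains a translate of the parallelepiped they span, shrunk by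
   [k + 1].  It contains a disc of radius [h / 2 (k + 1)], with [h] the least
   height, while [K] projected along all the vectors but the corresponding
   one has diameter about [h]. *)
Lemma section_projection k m n (K : set 'rV[R]_n) kappa :
  compact K -> convex_set K -> interior K !=set0 ->
  n = (k + m.+1)%N -> 1 < kappa ->
  exists (h : R) (A : 'M[R]_(k.+1, n)) (c : 'rV[R]_n) (U : 'M[R]_(m.+1, n)),
  [/\ 0 < h, row_free A,
      forall s, enorm (s *m A) <= h / (2 * k.+1%:R) -> K (c + s *m A),
      U *m U^T = 1%:M &
      forall x y, K x -> K y ->
        dotv (x *m U^T - y *m U^T) (x *m U^T - y *m U^T) <= kappa * h ^+ 2].
Proof.
move=> cK vK iK nE kappa1.
set M := [set x | exists a b, [/\ K a, K b & x = a - b]].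
have [B B0 MB] := compact_enorm_bounded (compact_sub cK).
have kn : (k.+1 <= n)%N by rewrite nE addnS ltnS leq_addr.
have [A0 MA0 gA0] := interior_gram_pos kn iK.
have [A [MA gA hmax]] := near_max_gram B0 MB kappa1 MA0 gA0.
have /choice[q /choice[U qU]] := fun j => near_max_row j nE MA gA hmax.
have /choice[a /choice[b abE]] := MA.
case: (@arg_minP _ R _ ord0 xpredT (fun j => dotv (q j) (q j))) => // j _ jmin.
have q0 l : 0 < dotv (q l) (q l) by case: (qU l).
have qn l : 0 < enorm (q l) by rewrite enorm_gt0 -dotv_gt0.
pose N : R := k.+1%:R.
have N0 : 0 < N by rewrite ltr0n.
(* The centre is the mean of the midpoints of the segments from [b l] to [a l]. *)
exists (enorm (q j)), A, (N^-1 *: \sum_l (2^-1 *: (a l + b l))), (U j).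
split => //; first by apply: gram_row_free; rewrite gt_eqF.
- move=> s hs.
  (* Pairing with [q l] isolates coordinate [l], and [|q l|] is at least the least height
     [|q j|]. *)
  have sb l : `|s 0 l| * N <= 2^-1.
    have sq : dotv (s *m A) (q l) = s 0 l * dotv (q l) (q l).
      rewrite dotvC mulmx_sum_row dotv_sumr (bigD1 l)//= big1 => [|l' l'l].
        by rewrite dotvZr; have [_ -> _ _] := qU l; rewrite eqxx mul1r addr0.
      by rewrite dotvZr; have [_ -> _ _] := qU l; rewrite (negPf l'l) mul0r mulr0.
    have : `|s 0 l| * enorm (q l) <= enorm (s *m A).
      rewrite -(ler_pM2r (qn l)) -mulrA -expr2 enorm_sq.
      by rewrite -[dotv (q l) _]ger0_norm ?dotv_ge0// -normrM -sq dotv_abs_le.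
    have qj : enorm (q j) <= enorm (q l).
      by rewrite enorm_leP ?enorm_ge0// enorm_sq jmin.
    move=> h1; have h2 := le_trans h1 hs.
    have h3 : `|s 0 l| * enorm (q l) <= enorm (q l) / (2 * N).
      by apply: le_trans h2 _; rewrite ler_pM2r// invr_gt0 mulr_gt0.
    rewrite -ler_pdivlMr// -invfM.
    by rewrite -(ler_pM2r (qn l)) [leRHS]mulrC.
  (* The displacement moves the [l]-th midpoint by [N * s 0 l] times its segment, by [sb] at most
     half of it, so each point stays on its segment. *)
  have -> : N^-1 *: \sum_l (2^-1 *: (a l + b l)) + s *m A =
      N^-1 *: \sum_l ((2^-1 + N * s 0 l) *: a l + (1 - (2^-1 + N * s 0 l)) *: b l).
    rewrite mulmx_sum_row -[\sum_l s 0 l *: _]scale1r -(mulVf (lt0r_neq0 N0)).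
    rewrite -scalerA -scalerDr scaler_sumr -big_split/=; congr (_ *: _).
    apply: eq_bigr => l _; have [_ _ ->] := abE l.
    by apply/rowP => t; rewrite !mxE; field.
  apply: convex_mean => // l; have [Ka Kb _] := abE l.
  have : `|N * s 0 l| <= 2^-1 by rewrite mulrC normrM (ger0_norm (ltW N0)).
  rewrite ler_norml => /andP[h1 h2].
  by move/convex_setP: vK; apply => //; lra.
- by case: (qU j).
- move=> x y Kx Ky; rewrite -mulmxBl enorm_sq; have [_ _ _ h] := qU j.
  by apply: h; exists x, y.
Qed.

Lemma row_space_vspace k n (A : 'M[R]_(k, n)) : row_free A ->
  exists V : {vspace 'rV[R]_n}, \dim V = k /\
    forall y, (y \in V) <-> exists s, y = s *m A.
Proof.
move=> Afree; pose f : 'Hom('rV[R]_k, 'rV[R]_n) := linfun (mulmxr A).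
have fE s : f s = s *m A by rewrite lfunE.
exists (limg f); split.
  have := limg_ker_dim f fullv; rewrite capfv.
  have -> : lker f = 0%VS.
    apply/eqP/lker0P => s t; rewrite !fE; exact: row_free_inj.
  by rewrite dimv0 add0n dimvf /dim/= mul1n.
move=> y; split => [/memv_imgP[s _ ->]|[s ->]]; first by exists s; rewrite fE.
by rewrite -fE memv_img ?memvf.
Qed.

Lemma orthonormal_row_free m n (U : 'M[R]_(m, n)) : U *m U^T = 1%:M -> row_free U.
Proof. by move=> UU; apply/row_freeP; exists U^T. Qed.

(** The row space of [U] is one of the competing subspaces, and the projection of [x] onto it has
    coordinates [x *m U^T]. *)
Lemma outer_radius_le m n (K : set 'rV[R]_n) (U : 'M[R]_(m, n)) c rho :
  U *m U^T = 1%:M -> 0 <= rho ->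
  (forall x, K x -> enorm (x *m U^T - c) <= rho) -> outer_radius m K <= rho.
Proof.
move=> UU rho0 hK.
have [V [dV VE]] := row_space_vspace (orthonormal_row_free UU).
pose L := [set x : 'rV[R]_n | x - 0 \in V].
(* This lower bound lets the infimum over subspaces be compared with one member; an unbounded set
   gets the value [inf set0 = 0]. *)
have circ_ge0 (C : set 'rV[R]_n) : 0 <= circumradius C.
  have [C0|C0] := pselect ([set rho | 0 <= rho /\ exists c, C `<=` eball c rho] !=set0).
    by apply: lb_le_inf => // r [].
  by move/nonemptyPn: C0; rewrite /circumradius => ->; rewrite inf0.
apply: (@le_trans _ _ (circumradius (orth_proj L K))).
  apply: ge_inf; first by exists 0 => _ [L' _ <-].
  by exists L => //; exists 0, V.
apply: ge_inf; first by exists 0 => r [].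
split => //; exists (c *m U) => y [Ly [x Kx xy]]; rewrite /eball/=.
have [s yE] : exists s, y = s *m U by apply/VE; rewrite -(subr0 y).
have sE : s = x *m U^T.
  have UUx : (x - y) *m U^T = 0.
    apply/eqP; rewrite -dotv_eq0; set t := _ *m U^T.
    rewrite {2}/t -dotv_mulmx dotvC.
    have := xy (y + t *m U); rewrite addrAC subrr add0r => ->//.
    rewrite /L/= subr0; apply/VE; exists (s + t); by rewrite mulmxDl yE.
  move/eqP: UUx; rewrite mulmxBl yE -mulmxA UU mulmx1 subr_eq0 => /eqP->//.
by rewrite yE -mulmxBl enorm_isometry// sE; exact: hK.
Qed.

(** As [i] is positive, the disc contains a diameter, whose endpoints in [K] are at most [2 * B]
    apart. Hence the suprema defining the inner radius are over bounded sets. *)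
Lemma inner_disc_bound n i (K L : set 'rV[R]_n) B r :
  (0 < i)%N -> affine_subspace i L -> (forall x, K x -> enorm x <= B) ->
  0 <= r -> (exists2 c, L c & L `&` eball c r `<=` K `&` L) -> r <= B.
Proof.
move=> i0 [p [V [dV ->]]] KB r0 [c cV sub].
have v0 : vpick V != 0 by rewrite vpick0 -dimv_eq0 dV -lt0n.
set u := (enorm (vpick V))^-1 *: vpick V.
have u1 : enorm u = 1 by exact: enorm_normalize.
have uV : u \in V by rewrite memvZ ?memv_pick.
have Ku t : `|t| <= r -> K (c + t *: u).
  move=> tr; suff [] : (K `&` [set x | x - p \in V]) (c + t *: u) by [].
  apply: sub; split => /=; first by rewrite addrAC; apply: memvD; [exact: cV | exact: memvZ].
  by rewrite /eball/= addrAC subrr add0r enormZ u1 mulr1.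
have h1 := KB _ (Ku r _); have h2 := KB _ (Ku (- r) _).
have : enorm ((c + r *: u) - (c + (- r) *: u)) <= 2 * B.
  apply: le_trans (enormB _ _) _.
  have := h1 _; have := h2 _; rewrite normrN ger0_norm// => /(_ (lexx _)) + /(_ (lexx _)); lra.
have -> : (c + r *: u) - (c + (- r) *: u) = (2 * r) *: u.
  by apply/rowP => j; rewrite !mxE; ring.
rewrite enormZ u1 mulr1 ger0_norm ?mulr_ge0//; lra.
Qed.

Lemma inner_radius_ge i n (K : set 'rV[R]_n) (A : 'M[R]_(i, n)) c rho :
  compact K -> (0 < i)%N -> row_free A -> 0 <= rho ->
  (forall s, enorm (s *m A) <= rho -> K (c + s *m A)) -> rho <= inner_radius i K.
Proof.
move=> cK i0 Afree rho0 hK.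
have [B B0 KB] := compact_enorm_bounded cK.
have [V [dV VE]] := row_space_vspace Afree.
pose L := [set x : 'rV[R]_n | x - c \in V].
have affL : affine_subspace i L by exists c, V.
have Lc : L c by rewrite /L/= subrr mem0v.
have Kc : K c by rewrite -[c]addr0 -(mul0mx _ A); apply: hK; rewrite mul0mx enorm0.
apply: (@le_trans _ _ (inradius L (K `&` L))).
  apply: ub_le_sup.
    by exists B => r [r0]; exact: inner_disc_bound i0 affL KB r0.
  split => //; exists c => // x [Lx]; rewrite /eball/= => xr.
  have [s xE] : exists s, x - c = s *m A by apply/VE.
  by split => //; rewrite -(subrK c x) addrC xE; apply: hK; rewrite -xE.
apply: ub_le_sup; last by exists L => //; split => //; exists c.
exists B => _ [L' [affL' _] <-].
rewrite /inradius; set E := (X in sup X).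
have [E0|/nonemptyPn E0] := pselect (E !=set0); last by rewrite E0 sup0.
by apply: ge_sup => // r [r0]; exact: inner_disc_bound i0 affL' KB r0.
Qed.

(** * The two bounds, with slack above the inner radius *)

Lemma le_mul_of_gt (X c rho0 : R) :
  0 < c -> (forall rho, rho0 < rho -> X <= c * rho) -> X <= c * rho0.
Proof.
move=> c0 h; rewrite leNgt; apply/negP => hX.
pose rho := (rho0 + X / c) / 2.
have e : c * rho = (c * rho0 + X) / 2 by rewrite /rho; field; rewrite gt_eqF.
have rho_gt : rho0 < rho by rewrite -(ltr_pM2l c0) e; lra.
have := h _ rho_gt; rewrite e; lra.
Qed.

(** Here [k.+1] is [i] and [d] is [n - i]. Each of the [d.+1] coordinates along the flat directions
    deviates by at most [h], which gives a ball of radius [Num.sqrt d.+1%:R * h]. *)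
Lemma outer_le_flat d k (K : set 'rV[R]_(d + k.+1)) rho :
  convex_body K -> inner_radius k.+1 K < rho ->
  outer_radius d.+1 K <=
    2 ^+ d * Num.sqrt (d.+1%:R * k.+2%:R) * rho.
Proof.
move=> [cK vK [x0 x0K]] hrho.
have K0 : K !=set0 by exists x0; exact: interior_subset.
have hin r : 0 <= r -> disc_in k.+1 r K -> r <= inner_radius k.+1 K.
  move=> r0 [A [c [AA hA]]]; apply: (inner_radius_ge cK _ (orthonormal_row_free AA)) => // s.
  by rewrite enorm_isometry//; exact: hA.
have in0 : 0 <= inner_radius k.+1 K.
  apply: hin => //; exists (row_mx 0 1%:M), x0.
  split; first by rewrite tr_row_mx mul_row_col trmx0 trmx1 mulmx0 mulmx1 add0r.
  move=> s s0; have /eqP -> : s == 0 by rewrite -enorm_eq0 eq_le s0 enorm_ge0.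
  by rewrite mul0mx addr0; exact: interior_subset.
have [U [b [UU hU]]] := flat_directions K0 cK vK hin hrho.
set h := 2 ^+ d * _ in hU.
have h0 : 0 <= h.
  by rewrite mulr_ge0 ?exprn_ge0// mulr_ge0 ?sqrtr_ge0// ltW// (le_lt_trans in0).
have -> : 2 ^+ d * Num.sqrt (d.+1%:R * k.+2%:R) * rho = Num.sqrt d.+1%:R * h.
  by rewrite sqrtrM ?ler0n// /h; ring.
apply: (outer_radius_le (c := b) UU); first by rewrite mulr_ge0 ?sqrtr_ge0.
move=> x Kx; rewrite enorm_leP; last by rewrite mulr_ge0 ?sqrtr_ge0.
rewrite exprMn sqr_sqrtr ?ler0n//.
have -> : d.+1%:R * h ^+ 2 = \sum_(l < d.+1) h ^+ 2.
  by rewrite sumr_const card_ord mulr_natl.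
apply: ler_sum => l _.
by rewrite -expr2 -real_normK ?num_real// ler_pXn2r ?nnegrE//; exact: hU.
Qed.

Lemma outer_le_jung d k (K : set 'rV[R]_(d + k.+1)) rho :
  convex_body K -> inner_radius k.+1 K < rho ->
  0 < inner_radius k.+1 K /\
  outer_radius d.+1 K <=
    k.+1%:R * Num.sqrt 2 * Num.sqrt (1 - 1 / d.+2%:R) * rho.
Proof.
move=> [cK vK iK]; set rho0 := inner_radius _ _ => hrho.
have nE : (d + k.+1)%N = (k + d.+1)%N by rewrite addnC addSnnS.
have hin kappa : 1 < kappa -> exists h U, [/\ 0 < h, h <= 2 * k.+1%:R * rho0,
    U *m U^T = 1%:M :> 'M[R]_d.+1 &
    forall x y, K x -> K y ->
      dotv (x *m U^T - y *m U^T) (x *m U^T - y *m U^T) <= kappa * h ^+ 2].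
  move=> kappa1.
  have [h [A [c [U [h0 Afree hA UU hU]]]]] := section_projection cK vK iK nE kappa1.
  have N0 : 0 < 2 * k.+1%:R :> R by rewrite mulr_gt0// ltr0n.
  exists h, U; split => //.
  rewrite mulrC -ler_pdivrMr//.
  by apply: (inner_radius_ge cK _ Afree _ hA) => //; rewrite divr_ge0// ltW.
have rho00 : 0 < rho0.
  have [h [U [h0 hh _ _]]] := hin 2 (ltr1n _ _).
  have := lt_le_trans h0 hh; rewrite pmulr_rgt0// mulr_gt0// ltr0n.
have rhop : 0 < rho by exact: lt_trans hrho.
split => //.
(* With this factor, [D ^+ 2 <= 4 * N ^+ 2 * rho * rho0 < 4 * N ^+ 2 * rho ^+ 2], which yields the
   strict inequality that [jung] asks for. *)
have kappa1 : 1 < rho / rho0 by rewrite ltr_pdivlMr// mul1r.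
have [h [U [h0 hh UU hU]]] := hin _ kappa1.
set N : R := k.+1%:R in hh *; have N0 : 0 < N by rewrite ltr0n.
set S := (fun x => x *m U^T) @` K.
have S0 : S !=set0.
  by case: iK => x /interior_subset Kx; exists (x *m U^T), x.
have q1 : 0 < 1 - d.+2%:R^-1 :> R.
  by rewrite subr_gt0 invf_lt1 ?ltr1n ?ltr0n.
set C := N * _ * _.
have C2 : C ^+ 2 = N ^+ 2 * 2 * (1 - d.+2%:R^-1).
  by rewrite /C div1r !exprMn !sqr_sqrtr// ltW.
have C0 : 0 <= C by rewrite !mulr_ge0 ?sqrtr_ge0// ltW.
pose D := Num.sqrt (rho / rho0) * h.
have D2 : D ^+ 2 = rho / rho0 * h ^+ 2.
  by rewrite exprMn sqr_sqrtr// divr_ge0// ltW.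
have D0 : 0 <= D by rewrite mulr_ge0 ?sqrtr_ge0// ltW.
have [||| c hc] := @jung R d.+1 S D (C * rho) S0.
- move=> _ _ [x Kx <-] [y Ky <-]; rewrite enorm_leP// D2; exact: hU.
- by rewrite mulr_ge0// ltW.
- rewrite D2 (exprMn _ C) C2.
  have h2 : h ^+ 2 <= (2 * N * rho0) ^+ 2.
    by rewrite ler_pXn2r ?nnegrE// ltW// !mulr_gt0.
  have e : rho / rho0 * (2 * N * rho0) ^+ 2 / 2 = 2 * N ^+ 2 * (rho * rho0).
    by field; rewrite gt_eqF.
  have h3 : rho / rho0 * h ^+ 2 / 2 <= 2 * N ^+ 2 * (rho * rho0).
    by rewrite -e ler_pM2r ?invr_gt0// ler_pM2l// divr_gt0.
  have h4 : rho * rho0 < rho ^+ 2 by rewrite expr2 ltr_pM2l.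
  have h5 : 2 * N ^+ 2 * (rho * rho0) < 2 * N ^+ 2 * rho ^+ 2.
    by rewrite ltr_pM2l// mulr_gt0// exprn_gt0.
  have -> : N ^+ 2 * 2 * (1 - d.+2%:R^-1) * rho ^+ 2 =
      2 * N ^+ 2 * rho ^+ 2 * (1 - d.+2%:R^-1) by ring.
  by rewrite ltr_pM2r// (le_lt_trans h3).
apply: (outer_radius_le (c := c) UU); first by rewrite mulr_ge0// ltW.
by move=> x Kx; apply: (hc (x *m U^T)); exists x.
Qed.

End Radii.

Theorem theorem1p1 (R : realType) (n : nat) (hn : (3 <= n)%N)
    (K : set 'rV[R]_n) (hK : convex_body K)
    (i : nat) (hi : (2 <= i <= n - 1)%N) :
  outer_radius (n - i + 1) K / inner_radius i K <=
  Num.min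
    (i%:R * Num.sqrt 2 * Num.sqrt (1 - 1 / (n - i + 2)%:R))
    (2 ^+ (n - i) * Num.sqrt ((n - i + 1)%:R * (i + 1)%:R)).
Proof.
have /andP[i2 ilt] := hi.
have i_le_n : (i <= n)%N := leq_trans ilt (leq_subr _ _).
case: i i2 {hi ilt} i_le_n => // k _ kn.
rewrite -(subnK kn) in K hK *; set d := (n - k.+1)%N.
rewrite addnK !addn1 addn2.
have in0 : 0 < inner_radius k.+1 K.
  have h : inner_radius k.+1 K < inner_radius k.+1 K + 1 by rewrite ltrDl.
  by have [] := outer_le_jung hK h.
(* Both bounds hold for every [rho] above the inner radius; letting [rho] tend to it removes the
   slack. *)
rewrite le_min !ler_pdivrMr//; apply/andP; split.
  apply: le_mul_of_gt => [|rho /(outer_le_jung hK)[]//].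
  rewrite !mulr_gt0 ?sqrtr_gt0 ?ltr0n// div1r subr_gt0 invf_lt1 ?ltr1n ?ltr0n//.
apply: le_mul_of_gt => [|rho /(outer_le_flat hK)//].
by rewrite mulr_gt0 ?exprn_gt0// sqrtr_gt0 mulr_gt0 ?ltr0n.
Qed.
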